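(* Let $V:\mathcal X\to\mathbb R_+$ be continuous and let $\mathfrak F=\{f\in B(\mathcal X):|f(x)|\le1+V(x)\ \forall x\}$ satisfy Hypothesis $(\mathbf{H_2})$. Then the following are equivalent: (i) $\Phi$ admits a unique invariant probability measure $\mu$ with $\mathfrak F\subset L^1(\mu)$ and $\lim_{t\to\infty}d_V(Q_t(x,\cdot),\mu)=0$ for all $x\in\mathcal X$; (ii) $\Phi$ is uniformly Cesàro eventually continuous with respect to $\mathfrak F$ on $\mathcal X$, and there exists $z\in\mathcal X$ such that $\Phi$ satisfies $(\mathcal C_2)$ at $z$; (iii) there exists $z\in\mathcal X$ such that $\Phi$ is uniformly Cesàro eventually continuous with respect to $\mathfrak F$ at $z$ and satisfies $(\mathcal C_2)$ at $z$.
   Context: Standing setting: $(\mathcal{X},\rho)$ is a Polish space; $\Phi=\{\Phi_t\}_{t\ge0}$ is a càdlàg Feller Markov process on $\mathcal{X}$ (hence strong Markov) with laws $\mathbb{P}^x$ and transition kernels $P_t(x,\cdot)$. $B(\mathcal X)$: Borel real functions; $B(z,r)$: open ball. $\mathcal{A}=\{f\in B(\mathcal{X}):\int|f|\,dP_t(x,\cdot)<\infty\ \forall x,t\}$; for $f\in\mathcal A$, $P_tf(x)=\int f\,dP_t(x,\cdot)$, $Q_tf(x)=\frac1t\int_0^tP_sf(x)ds$; $Q_t(x,\cdot)=\frac1t\int_0^tP_s(x,\cdot)ds$. For probability measures $\mu,\nu$ with $\int V d\mu,\int Vd\nu<\infty$, $d_V(\mu,\nu)=\inf_\pi\int_{\{x\neq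 y\}}(2+V(x)+V(y))\pi(dx,dy)$, the infimum over couplings $\pi$ of $\mu$ and $\nu$. $(\mathcal C_2)$ at $z$: for every $r>0$, $\inf_{x\in\mathcal X}\limsup_{t\to\infty}Q_t(x,B(z,r))>0$. $\Phi$ is uniformly Cesàro eventually continuous with respect to $\mathfrak F$ at $x$ if $\limsup_{x'\to x}\limsup_{t\to\infty}\sup_{f\in\mathfrak F}|Q_tf(x')-Q_tf(x)|=0$; ''on $\mathcal X$'' means at every point. Uniform integrability of $\{\xi_t\}$: $\lim_{K\to\infty}\sup_t\mathbb E(|\xi_t|\chi_{\{|\xi_t|\ge K\}})=0$. Hypothesis $(\mathbf{H_2})$: there is $\tilde V\in\mathcal A$ with $|f|\le\tilde V$ for all $f\in\mathfrak F$, such that $\{\tilde V(\Phi_t)\}_{t\ge0}$ is uniformly integrable under every $\mathbb P^x$. *)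

(* Defs.v *)
From HB Require Import structures.
From mathcomp Require Import all_boot all_order all_algebra.
From mathcomp Require Import all_classical all_reals all_analysis measurable_realfun.
Set Implicit Arguments. Unset Strict Implicit. Unset Printing Implicit Defensive.
Import Order.TTheory GRing.Theory Num.Theory.
Local Open Scope classical_set_scope.
Local Open Scope ring_scope.

Section Defs.
Context {R : realType}.

Section Metric.
Context {X : Type} (rho : X -> X -> R).

Definition is_metric : Prop :=
  [/\ forall x y, 0 <= rho x y,
      forall x y, rho x y = 0 <-> x = y,
      forall x y, rho x y = rho y x &
      forall x y z, rho x z <= rho x y + rho y z].

Definition rball (z : X) (r : R) : set X := [set y | rho z y < r].

Definition ropen (A : set X) : Prop :=
  forall x, A x -> exists r, 0 < r /\ rball x r `<=` A.

Definition rcauchy (u : nat -> X) : Prop :=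
  forall e, 0 < e -> exists N, forall m n, (N <= m)%N -> (N <= n)%N -> rho (u m) (u n) < e.

Definition polish : Prop :=
  [/\ is_metric,
      (forall u, rcauchy u -> exists l, forall e, 0 < e ->
          exists N, forall n, (N <= n)%N -> rho (u n) l < e) &
      (exists D : nat -> X, forall x e, 0 < e -> exists n, rho x (D n) < e)].

Definition rcontinuous (f : X -> R) : Prop :=
  forall x e, 0 < e -> exists d, 0 < d /\ forall y, rho x y < d -> `|f y - f x| < e.

Definition rlimsup_at (x : X) (g : X -> \bar R) : \bar R :=
  ereal_inf [set ereal_sup (g @` rball x d) | d in [set d : R | 0 < d]].

Definition cadlag (w : R -> X) : Prop :=
  (forall t, 0 <= t -> forall e, 0 < e -> exists d, 0 < d /\
      forall s, t <= s -> s < t + d -> rho (w t) (w s) < e) /\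
  (forall t, 0 < t -> exists l, forall e, 0 < e -> exists d, 0 < d /\
      forall s, t - d < s -> s < t -> rho l (w s) < e).
End Metric.

Definition limsup_infty (g : R -> \bar R) : \bar R :=
  ereal_inf [set ereal_sup (g @` [set t | T <= t]) | T in [set: R]].

Section Process.
Context {d : measure_display} {X : measurableType d}
        {dO : measure_display} {Omega : measurableType dO}
        (Px : X -> probability Omega R) (Phi : R -> Omega -> X).

Definition Pt (t : R) (x : X) (A : set X) : \bar R := Px x (Phi t @^-1` A).

(* P_t f (x) = \int f dP_t(x, .) = E^x f(Phi_t) *)
Definition Pf (t : R) (f : X -> R) (x : X) : R :=
  fine (\int[Px x]_w (f (Phi t w))%:E)%E.

Definition Qf (t : R) (f : X -> R) (x : X) : R :=
  t^-1 * fine (\int[lebesgue_measure]_(s in [set s : R | (0 <= s <= t)%R]) (Pf s f x)%:E)%E.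

Definition Qt (t : R) (x : X) (A : set X) : R := Qf t (\1_A) x.

Definition nat_filtration (s : R) : set (set Omega) :=
  <<s [set E | exists r (B : set X), [/\ 0 <= r <= s, measurable B & E = Phi r @^-1` B]] >>.

Definition in_A (f : X -> R) : Prop :=
  measurable_fun setT f /\
  forall x t, 0 <= t -> (Px x).-integrable setT (fun w => (f (Phi t w))%:E).

Definition cadlag_feller_markov (rho : X -> X -> R) : Prop :=
  [/\ (forall t, 0 <= t -> measurable_fun setT (Phi t)),
      (forall w, cadlag rho (fun t => Phi t w)),
      (forall x, Px x [set w | Phi 0 w = x] = 1%E) /\
      (forall t B, 0 <= t -> measurable B -> measurable_fun [set: X] (fun y => Pt t y B)),
      (forall x s t A B, 0 <= s -> 0 <= t -> nat_filtration s A -> measurable B ->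
          Px x (A `&` Phi (s + t) @^-1` B) = (\int[Px x]_(w in A) Pt t (Phi s w) B)%E) &
      (forall t f, 0 <= t -> (exists M, forall x, `|f x| <= M) -> rcontinuous rho f ->
          rcontinuous rho (Pf t f))].

Definition H2 (FF : set (X -> R)) : Prop :=
  exists Vt : X -> R, [/\ in_A Vt,
    (forall f, FF f -> forall x, `|f x| <= Vt x) &
    forall x, (fun K : R => ereal_sup [set (\int[Px x]_(w in [set w | (K <= `|Vt (Phi t w)|)%R])
                                           (`|Vt (Phi t w)|)%R%:E)%E | t in [set t : R | 0 <= t]])
              @ +oo%R --> 0%E].

Definition ucec_at (rho : X -> X -> R) (FF : set (X -> R)) (x : X) : Prop :=
  rlimsup_at rho x (fun x' => limsup_infty (fun t =>
      ereal_sup [set (`|Qf t f x' - Qf t f x|)%:E | f in FF])) = 0%E.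

Definition C2_at (rho : X -> X -> R) (z : X) : Prop :=
  forall r, 0 < r ->
    (0 < ereal_inf [set limsup_infty (fun t => (Qt t x (rball rho z r))%:E) | x in [set: X]])%E.

Definition is_invariant (mu : probability X R) : Prop :=
  forall t A, 0 <= t -> measurable A -> (\int[mu]_y Pt t y A)%E = mu A.

Definition dV_Q (V : X -> R) (t : R) (x : X) (mu : probability X R) : \bar R :=
  ereal_inf [set (\int[pi]_(p in [set p : X * X | p.1 <> p.2]) (2 + V p.1 + V p.2)%R%:E)%E
            | pi in [set pi : probability (X * X)%type R |
                 forall A, measurable A ->
                   pi (A `*` setT) = (Qt t x A)%:E /\ pi (setT `*` A) = mu A]].
End Process.

Definition FF_V {d} {X : measurableType d} (V : X -> R) : set (X -> R) :=
  [set f : X -> R | measurable_fun setT f /\ forall x, `|f x| <= 1 + V x].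

End Defs.

(* Main.v *)
Require Import Defs.
From HB Require Import structures.
From mathcomp Require Import all_boot all_order all_algebra.
From mathcomp Require Import all_classical all_reals all_analysis measurable_realfun.
From mathcomp Require Import giry lra ring.
Set Implicit Arguments. Unset Strict Implicit. Unset Printing Implicit Defensive.
Import Order.TTheory GRing.Theory Num.Theory.
Import numFieldNormedType.Exports.
Local Open Scope classical_set_scope.
Local Open Scope ring_scope.

(** The implication (iii) => (i) carries the weight. Write [Q_T(x)] for the time averages and
    [q_T = Q_T(z)].
    (1) Merging: if [L] bounds [limsup_T ||Q_T(y) - q_T||] in total variation for all [y], then
    averaging over one [Q_t(x)], which charges a ball around [z] with mass at least [a] (C2), gives
    [L <= L - a (L - e)], whence [L = 0]: all averages merge with [q_T].
    (2) Domination: merging and the Feller property make [X] a countable union of closed sets on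
    which the merging is uniform in [T >= N] up to [e]. Baire's theorem, relative to the set of
    points all of whose balls recur (it contains [z] and has full [q_T]-measure), yields a recurrent
    ball on which it is uniform; restarting there gives [gam (q_T(A) - e) <= q_S(A) + T/S] for
    [T >= N] and arbitrarily large [S].
    (3) As disjoint sets cannot all have large [q_S]-measure, [q_T(A_n)] is eventually small,
    uniformly in [T], whenever [A_n] decreases to the empty set. Applied to the complements of the
    closed sets of (2) this makes [q_T] Cauchy in total variation; its limit is invariant.
    (4) Uniform integrability and a maximal coupling turn total variation into [d_V]. *)

(** * Expectations of unit-interval valued functions *)

Section Expectation.
Context {R : realType} {d : measure_display} {X : measurableType d}.
Implicit Types (m : probability X R) (f g : X -> R) (A : set X).

(** The obstacle is that every threshold in time depends on the starting point: Cesàro continuity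
    and merging hold at [y] only from some [T0] depending on [y], and (C2) gives visits only along
    an unbounded set of times. No compactness makes this uniform, and merging alone does not say
    that [q_T] settles as [T] grows. Baire's theorem recovers uniformity on one ball, and domination
    turns that into control of all late averages at once. A second obstacle is that the Feller
    property speaks of continuous functions only. The closed sets of (2) are therefore defined by
    continuous test functions, and Borel sets are reached at the end of each estimate by
    approximating an indicator in $L^1$ of both averages being compared. The recurring error [T / S]
    is the price of inserting a run of length [T] before or after an average of length [S]. Averages
    are mixtures over a uniform random time, whose joint measurability comes from the
    right-continuous paths. Test functions with values in [0,1] keep expectations real-valued; the
    weight [V] matters only for identifying [Qf] with an expectation and in (4). *)

Definition unit_fun f : Prop := measurable_fun setT f /\ forall x, 0 <= f x <= 1.

Definition expect m f : R := \int[m]_x f x.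

Lemma integrable_bounded m f (M : R) : measurable_fun setT f ->
  (forall x, `|f x| <= M) -> m.-integrable setT (EFin \o f).
Proof.
move=> mf fM; apply: (@le_integrable _ _ _ m setT measurableT _ (EFin \o cst M)) => //.
- exact/measurable_EFinP.
- move=> x _ /=; by rewrite lee_fin (le_trans (fM x))// ler_norm.
- exact: (@finite_measure_integrable_cst _ _ _ m).
Qed.

Lemma unit_fun_norm f x : unit_fun f -> `|f x| <= 1.
Proof. by move=> [_ /(_ x)/andP[f0 f1]]; rewrite ger0_norm. Qed.

Lemma unit_fun_integrable m f : unit_fun f -> m.-integrable setT (EFin \o f).
Proof.
move=> uf; apply: (@integrable_bounded _ _ 1); first by case: uf.
by move=> x; exact: unit_fun_norm.
Qed.
#[local] Hint Resolve unit_fun_integrable : core.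

Lemma expectE m f : unit_fun f -> (\int[m]_x (f x)%:E)%E = (expect m f)%:E.
Proof. by move=> uf; rewrite fineK//; exact: integrable_fin_num (unit_fun_integrable m uf). Qed.

Lemma unit_fun_cst (c : R) : 0 <= c <= 1 -> unit_fun (fun _ => c).
Proof. by split => //; exact: measurable_cst. Qed.

Lemma unit_fun_indic A : measurable A -> unit_fun (\1_A).
Proof.
move=> mA; split; first exact: measurable_indic.
by move=> x; rewrite indicE; case: (x \in A); rewrite ?lexx ?ler01.
Qed.

Lemma unit_fun1B f : unit_fun f -> unit_fun (fun x => 1 - f x).
Proof.
move=> [mf f01]; split; first exact: measurable_funB.
by move=> x; have := f01 x; lra.
Qed.

Lemma unit_fun_dist f g : unit_fun f -> unit_fun g -> unit_fun (fun x => `|f x - g x|).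
Proof.
move=> [mf f01] [mg g01]; split.
  by apply: measurableT_comp => //; exact: measurable_funB.
move=> x; rewrite normr_ge0/= ler_norml; have := f01 x; have := g01 x; lra.
Qed.

Lemma unit_funM f g : unit_fun f -> unit_fun g -> unit_fun (fun x => f x * g x).
Proof.
move=> [mf f01] [mg g01]; split; first exact: measurable_funM.
move=> x; have /andP[f0 f1] := f01 x; have /andP[g0 g1] := g01 x.
by rewrite mulr_ge0//= mulr_ile1.
Qed.

Lemma expect_cst m (c : R) : expect m (fun _ => c) = c.
Proof. by rewrite /expect /Rintegral integral_cst//= probability_setT mule1. Qed.

Lemma expect_indic m A : measurable A -> (expect m (\1_A))%:E = m A.
Proof. by move=> mA; rewrite -expectE ?integral_indic ?setIT//; exact: unit_fun_indic. Qed.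

Lemma le_expect m f g : unit_fun f -> unit_fun g -> (forall x, f x <= g x) ->
  expect m f <= expect m g.
Proof. by move=> uf ug fg; apply: le_Rintegral => //; exact: unit_fun_integrable. Qed.

Lemma expect_ge0 m f : (forall x, 0 <= f x) -> 0 <= expect m f.
Proof. by move=> f0; exact: Rintegral_ge0. Qed.

Lemma expect_le1 m f : unit_fun f -> expect m f <= 1.
Proof.
move=> uf; rewrite -(expect_cst m 1); apply: le_expect => //.
  by apply: unit_fun_cst; rewrite ler01 lexx.
by case: uf => _ h x; case/andP: (h x).
Qed.

Lemma expectD m f g : m.-integrable setT (EFin \o f) -> m.-integrable setT (EFin \o g) ->
  expect m (fun x => f x + g x) = expect m f + expect m g.
Proof. by move=> *; exact: RintegralD. Qed.

Lemma expectB m f g : m.-integrable setT (EFin \o f) -> m.-integrable setT (EFin \o g) ->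
  expect m (fun x => f x - g x) = expect m f - expect m g.
Proof. by move=> *; exact: RintegralB. Qed.

Lemma expect1B m f : unit_fun f -> expect m (fun x => 1 - f x) = 1 - expect m f.
Proof.
move=> uf; rewrite expectB ?expect_cst//.
  by apply: unit_fun_integrable; apply: unit_fun_cst; rewrite ler01 lexx.
exact: unit_fun_integrable.
Qed.

Lemma expect_dist m f g : unit_fun f -> unit_fun g ->
  `|expect m f - expect m g| <= expect m (fun x => `|f x - g x|).
Proof.
move=> uf ug; rewrite -expectB; [|exact: unit_fun_integrable..].
apply: le_normr_Rintegral => //.
apply: (@integrable_bounded _ _ 1).
  by apply: measurable_funB; [case: uf|case: ug].
move=> x; have [_ h] := unit_fun_dist uf ug; by case/andP: (h x).
Qed.

Lemma expect_close m f g (c : R) : unit_fun f -> unit_fun g ->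
  (forall x, `|f x - g x| <= c) -> `|expect m f - expect m g| <= c.
Proof.
move=> uf ug fgc; apply: (le_trans (expect_dist m uf ug)).
rewrite -[leRHS](expect_cst m c); apply: le_Rintegral => //.
- by apply: unit_fun_integrable; exact: unit_fun_dist.
- exact: finite_measure_integrable_cst.
Qed.

Lemma expect_cvg m (f_ : nat -> X -> R) f : (forall n, unit_fun (f_ n)) ->
  unit_fun f -> (forall x, f_ ^~ x @ \oo --> f x) ->
  (fun n => expect m (f_ n)) @ \oo --> expect m f.
Proof.
move=> uf_ uf ff.
have [|||||_ _ h] := @dominated_convergence _ _ _ m setT measurableT
  (fun n x => (f_ n x)%:E) (EFin \o f) (EFin \o cst 1).
- by move=> n; apply/measurable_EFinP; case: (uf_ n).
- by apply/measurable_EFinP; case: uf.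
- by apply: aeW => x _; apply: cvg_EFin; [exact: nearW|exact: ff].
- exact: (@finite_measure_integrable_cst _ _ _ m).
- by apply: aeW => x n _ /=; rewrite lee_fin; exact: unit_fun_norm.
- by move: h; rewrite expectE// => /fine_cvg.
Qed.

End Expectation.

Lemma unit_fun_expect (R : realType) d d' (X : measurableType d) (Y : measurableType d')
    (K : Y -> probability X R)
    (f : X -> R) :
  (forall A, measurable A -> measurable_fun setT (fun y => K y A)) ->
  unit_fun f -> unit_fun (fun y => expect (K y) f).
Proof.
move=> mK uf; split; last first.
  by move=> y; rewrite expect_le1// expect_ge0// => x; case: uf => _ /(_ x)/andP[].
apply: (measurableT_comp (fine_measurable measurableT)).
apply: (@measurable_fun_integral_kernel _ _ _ _ _ (fun y => K y)) => //.
- by move=> x; rewrite lee_fin; case: uf => _ /(_ x)/andP[].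
- by apply/measurable_EFinP; case: uf.
Qed.

(** * Metric balls and continuous approximation of open sets *)

Section Metric.
Context {R : realType} {d : measure_display} {X : measurableType d} (rho : X -> X -> R).
Hypothesis rho_metric : is_metric rho.
Implicit Types (f g : X -> R) (x y z : X) (U : set X).

Let rho_ge0 x y : 0 <= rho x y. Proof. by case: rho_metric. Qed.
Let rhoC x y : rho x y = rho y x. Proof. by case: rho_metric. Qed.
Let rhoxx x : rho x x = 0. Proof. by case: rho_metric => _ h _ _; apply/h. Qed.
Let rhoD y x z : rho x z <= rho x y + rho y z. Proof. by case: rho_metric. Qed.

Lemma rball_center z (r : R) : 0 < r -> rball rho z r z.
Proof. by rewrite /rball/= rhoxx. Qed.

Lemma ropen_rball z (r : R) : ropen rho (rball rho z r).
Proof.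
move=> x; rewrite /rball/= => zx; exists (r - rho z x); split; first by rewrite subr_gt0.
by move=> y /= xy; have := rhoD x z y; lra.
Qed.

Lemma ropenI : setI_closed (ropen rho).
Proof.
move=> A B oA oB x [Ax Bx].
have [r [r0 rA]] := oA x Ax; have [s [s0 sB]] := oB x Bx.
exists (Num.min r s); split; first by rewrite lt_min r0.
by move=> y /=; rewrite /rball/= lt_min => /andP[xr xs]; split; [exact: rA|exact: sB].
Qed.

Lemma rcontinuous_lipschitz f (L : R) :
  (forall x y, `|f y - f x| <= L * rho x y) -> rcontinuous rho f.
Proof.
move=> fL x e e0; exists (e / (`|L| + 1)); split.
  by rewrite divr_gt0// ltr_wpDl.
move=> y; rewrite ltr_pdivlMr ?ltr_wpDl// => xy.
apply: le_lt_trans (fL x y) _; apply: le_lt_trans xy.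
rewrite mulrC ler_wpM2l//; have := ler_norm L; lra.
Qed.

Lemma rcontinuous1B f : rcontinuous rho f -> rcontinuous rho (fun x => 1 - f x).
Proof.
move=> cf x e e0; have [r [r0 h]] := cf x e e0; exists r; split => // y /h.
by rewrite -normrN; congr (`|_| < _); lra.
Qed.

Lemma rcontinuous_max f g : rcontinuous rho f -> rcontinuous rho g ->
  rcontinuous rho (fun x => Num.max (f x) (g x)).
Proof.
move=> cf cg x e e0; have [r [r0 hr]] := cf x e e0; have [s [s0 hs]] := cg x e e0.
exists (Num.min r s); split; first by rewrite lt_min r0.
move=> y; rewrite lt_min => /andP[/hr+ /hs].
rewrite !ltr_norml; case: (leP (f y) (g y)); case: (leP (f x) (g x)); lra.
Qed.

Definition dist_to (F : set X) x : R := inf [set rho x y | y in F].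

Lemma dist_to_lbound F x : has_lbound [set rho x y | y in F].
Proof. by exists 0 => _ [y _ <-]. Qed.

Lemma dist_to_lip F x y : F !=set0 -> dist_to F x <= rho x y + dist_to F y.
Proof.
move=> [a Fa]; rewrite -lerBlDl; apply: lb_le_inf; first by exists (rho y a), a.
move=> _ [b Fb <-]; rewrite lerBlDl (le_trans _ (rhoD y x b))//.
by apply: ge_inf; [exact: dist_to_lbound|exists b].
Qed.

(** The approximants are min(1, n dist(x, complement of U)): Lipschitz, zero off [U], and eventually
    1 at each point of [U]. They carry the Feller property from continuous functions to open
    sets. *)
Lemma ropen_approx U : ropen rho U -> exists g : nat -> X -> R,
  [/\ forall n, rcontinuous rho (g n), forall n x, 0 <= g n x <= \1_U x &
      forall x, g ^~ x @ \oo --> (\1_U x : R)].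
Proof.
(* When [U] is the whole space, the distance to its complement is the infimum of the empty set,
   whose default value 0 would give the wrong limit; the constant 1 is used instead. *)
move=> oU; have [UT|/set0P[a Ua]] := eqVneq (~` U) set0.
  have -> : U = setT by rewrite -(setCK U) UT setC0.
  exists (fun _ _ => 1); split => [_ x e e0|_ x|x].
  - by exists 1; split => // y _; rewrite subrr normr0.
  - by rewrite indicT ler01 lexx.
  - by rewrite indicT; exact: cvg_cst.
have lip x y := @dist_to_lip (~` U) x y (ex_intro _ a Ua).
have d0 x : 0 <= dist_to (~` U) x.
  by apply: lb_le_inf; [exists (rho x a), a|move=> _ [y _ <-]].
have dC x : x \notin U -> dist_to (~` U) x = 0.
  rewrite notin_setE => xU; apply/eqP; rewrite eq_le d0 andbT -(rhoxx x).
  by apply: ge_inf; [exact: dist_to_lbound|exists x].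
exists (fun n x => Num.min 1 (n%:R * dist_to (~` U) x)); split.
- move=> n; apply: (@rcontinuous_lipschitz _ n%:R) => x y.
  have n0 : 0 <= n%:R :> R by [].
  have := ler_wpM2l n0 (lip x y); have := ler_wpM2l n0 (lip y x).
  have := mulr_ge0 n0 (rho_ge0 x y).
  rewrite [rho y x]rhoC !mulrDr => r0 h1 h2; rewrite ler_norml.
  by case: (leP 1 (_ * dist_to _ x)); case: (leP 1 (_ * dist_to _ y)); lra.
- move=> n x; rewrite le_min ler01 mulr_ge0//= indicE; case: (boolP (x \in U)) => xU.
    by rewrite ge_min lexx.
  by rewrite dC// mulr0 ge_min lexx orbT.
- move=> x; rewrite indicE; case: (boolP (x \in U)) => xU; last first.
    rewrite dC//; apply: cvg_near_cst; apply: nearW => n.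
    by rewrite mulr0; apply/min_idPr.
  have [r [r0 rU]] := oU x (set_mem xU).
  have dr : r <= dist_to (~` U) x.
    apply: lb_le_inf; first by exists (rho x a), a.
    by move=> _ [y Uy <-]; rewrite leNgt; apply/negP => /rU.
  apply: cvg_near_cst; near=> n; apply/min_idPl.
  apply: le_trans (ler_wpM2l _ dr) => //.
  rewrite -ler_pdivrMr// mul1r; near: n; exact: nbhs_infty_ger.
Unshelve. all: by end_near. Qed.

Hypothesis borel : @measurable d X = <<s ropen rho >>.

Lemma ropen_measurable U : ropen rho U -> measurable U.
Proof. by move=> oU; rewrite borel; exact: sub_gen_smallest. Qed.

Lemma rcontinuous_measurable f : rcontinuous rho f -> measurable_fun setT f.
Proof.
move=> cf; apply: (measurability _ (RGenOInfty.measurableE R)) => _ [_ [a ->] <-].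
rewrite setTI; apply: ropen_measurable => x /=; rewrite in_itv/= andbT => ax.
have [|r [r0 h]] := cf x (f x - a); first by rewrite subr_gt0.
exists r; split => // y /h; rewrite ltr_norml /= in_itv/= andbT; lra.
Qed.

Lemma rcontinuous_unit f : rcontinuous rho f -> (forall x, 0 <= f x <= 1) -> unit_fun f.
Proof. by move=> cf f01; split => //; exact: rcontinuous_measurable. Qed.

Lemma ropen_approx_unit U : ropen rho U -> exists g : nat -> X -> R,
  [/\ forall n, rcontinuous rho (g n), forall n, unit_fun (g n),
      forall n x, g n x <= \1_U x & forall x, g ^~ x @ \oo --> (\1_U x : R)].
Proof.
move=> /ropen_approx[g [cg g01 gU]]; exists g; split => //.
  move=> n; apply: rcontinuous_unit => // x; have /andP[-> /= h] := g01 n x.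
  by apply: le_trans h _; rewrite indicE; case: (_ \in _).
by move=> n x; case/andP: (g01 n x).
Qed.
End Metric.

(** * Density of continuous functions, Baire category, Hahn splitting *)

Lemma cvgn_dist (R : realType) (u : nat -> R) (l : R) :
  u @ \oo --> l <-> forall e, 0 < e -> exists N, forall n, (N <= n)%N -> `|u n - l| <= e.
Proof.
split.
- move=> /cvgrPdist_le h e e0; have [N _ hN] := h e e0.
  by exists N => n Nn; rewrite distrC; exact: hN.
- move=> h; apply/cvgrPdist_le => e e0; have [N hN] := h e e0.
  by exists N => // n Nn /=; rewrite distrC; exact: hN.
Qed.

Section Density.
Context {R : realType} {d : measure_display} {X : measurableType d} (rho : X -> X -> R).
Hypothesis rho_metric : is_metric rho.
Hypothesis borel : @measurable d X = <<s ropen rho >>.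
Implicit Types (m : probability X R) (f g h : X -> R) (A B : set X).

Lemma expect_dist_trans m f g h : unit_fun f -> unit_fun g -> unit_fun h ->
  expect m (fun x => `|f x - h x|) <=
  expect m (fun x => `|f x - g x|) + expect m (fun x => `|g x - h x|).
Proof.
move=> uf ug uh; have i1 := unit_fun_integrable m (unit_fun_dist uf ug).
have i2 := unit_fun_integrable m (unit_fun_dist ug uh).
rewrite -expectD//; apply: le_Rintegral => //.
- by apply: unit_fun_integrable; exact: unit_fun_dist.
- exact: (integrableD measurableT i1 i2).
- by move=> x _; exact: ler_distD.
Qed.

Variables m1 m2 : probability X R.

Let approximable A := forall e : R, 0 < e -> exists g, [/\ rcontinuous rho g, unit_fun g,
  expect m1 (fun x => `|\1_A x - g x|) <= e & expect m2 (fun x => `|\1_A x - g x|) <= e].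

(** The maximum of the two approximants works, since the error for the union is pointwise at most
    the sum of the two errors. It provides the finite partial unions in the Dynkin argument. *)
Let approximableU A B : measurable A -> measurable B ->
  approximable A -> approximable B -> approximable (A `|` B).
Proof.
move=> mA mB aA aB e e0; have e20 : 0 < e / 2 by rewrite divr_gt0.
have [f [cf uf f1 f2]] := aA _ e20; have [g [cg ug g1 g2]] := aB _ e20.
have ufg : unit_fun (fun x => Num.max (f x) (g x)).
  apply: (rcontinuous_unit borel); first exact: rcontinuous_max.
  by move=> x; have [_ /(_ x) ?] := uf; have [_ /(_ x) ?] := ug; case: (leP (f x) (g x)).
have main m : expect m (fun x => `|\1_A x - f x|) <= e / 2 ->
    expect m (fun x => `|\1_B x - g x|) <= e / 2 ->
    expect m (fun x => `|\1_(A `|` B) x - Num.max (f x) (g x)|) <= e.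
  move=> h1 h2; rewrite [leRHS]splitr; apply: le_trans (lerD h1 h2).
  have i1 := unit_fun_integrable m (unit_fun_dist (unit_fun_indic (R := R) mA) uf).
  have i2 := unit_fun_integrable m (unit_fun_dist (unit_fun_indic (R := R) mB) ug).
  rewrite -expectD//; apply: le_Rintegral => //.
  - apply/unit_fun_integrable/unit_fun_dist => //.
    by apply: unit_fun_indic; exact: measurableU.
  - exact: (integrableD measurableT i1 i2).
  move=> x _; have [_ /(_ x)/andP[f0 f1']] := uf; have [_ /(_ x)/andP[g0 g1']] := ug.
  rewrite !indicE in_setU.
  case: (x \in A); case: (x \in B) => /=; case: (leP (f x) (g x)) => fg;
  rewrite ler_norml; have := ler_norm (1 - f x); have := ler_norm (1 - g x);
  have := ler_norm (f x - 0); have := ler_norm (g x - 0); rewrite ?(distrC _ (0 : R));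
  have := normr_ge0 (1 - f x); have := normr_ge0 (1 - g x); lra.
by exists (fun x => Num.max (f x) (g x)); split => //; [exact: rcontinuous_max|exact: main..].
Qed.

(** A single [g] must serve both measures: it will replace an indicator on the two sides of an
    inequality between two different averages. The class of approximable sets contains the open sets
    and is a Dynkin system. *)
Lemma continuous_dense A (e : R) : measurable A -> 0 < e ->
  exists g, [/\ rcontinuous rho g, unit_fun g,
  expect m1 (fun x => `|\1_A x - g x|) <= e & expect m2 (fun x => `|\1_A x - g x|) <= e].
Proof.
move=> + e0; rewrite borel => sA.
suff aA : approximable A by exact: aA.
move: A sA; apply: (@dynkin_induction _ _ (ropen rho)) => //.
- exact: ropenI.
- move=> {}e {}e0; exists (fun _ => 1).
  have u1 : unit_fun (fun _ : X => 1 : R) by apply: unit_fun_cst; rewrite ler01 lexx.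
  have E m : expect m (fun x => `|\1_[set: X] x - 1|) = 0.
    by rewrite -[RHS](expect_cst m); congr expect; apply/funext => x; rewrite indicT subrr normr0.
  split; rewrite ?E ?ltW//.
  by move=> x r r0; exists 1; split => // y _; rewrite subrr normr0.
- move=> U oU {}e {}e0; have [g [cg ug _ gU]] := ropen_approx_unit rho_metric borel oU.
  have uU := unit_fun_indic (R := R) (ropen_measurable borel oU).
  have lim m : (fun n => expect m (fun x => `|\1_U x - g n x|)) @ \oo --> (0 : R).
    rewrite -(expect_cst m 0); apply: expect_cvg.
    + by move=> n; exact: unit_fun_dist.
    + by apply: unit_fun_cst; rewrite ler01 lexx.
    + move=> x; rewrite -(normr0 R) -(subrr (\1_U x)).
      by apply: cvg_norm; apply: cvgB; [exact: cvg_cst|exact: gU].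
  have [N1 h1] := (cvgn_dist _ _).1 (lim m1) e e0.
  have [N2 h2] := (cvgn_dist _ _).1 (lim m2) e e0.
  exists (g (maxn N1 N2)); split => //.
  + by move: (h1 _ (leq_maxl N1 N2)); rewrite subr0; exact: le_trans (ler_norm _).
  + by move: (h2 _ (leq_maxr N1 N2)); rewrite subr0; exact: le_trans (ler_norm _).
- move=> A mA aA {}e {}e0; have [g [cg ug g1 g2]] := aA e e0.
  have E : (fun x => `|\1_(~` A) x - (1 - g x)| : R) = (fun x => `|\1_A x - g x|).
    apply/funext => x; rewrite !indicE in_setC; case: (_ \in _) => /=.
    + by rewrite -normrN; congr `|_|; lra.
    + by rewrite -normrN; congr `|_|; lra.
  exists (fun x => 1 - g x); rewrite E; split => //; first exact: rcontinuous1B.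
  exact: unit_fun1B.
(* Countable unions: a finite partial union is within e/2 of the full one under both measures, and
   is itself approximable within e/2. *)
- move=> F mF tF aF {}e {}e0; pose U n := \big[setU/set0]_(i < n) F i.
  have mU n : measurable (U n) by exact: bigsetU_measurable.
  have aU n : approximable (U n).
    elim: n => [|n IH]; last first.
      by rewrite /U big_ord_recr/=; exact: (approximableU (mU n) (mF n) IH (aF n)).
    rewrite /U big_ord0 => r r0; exists (fun _ => 0).
    have u0 : unit_fun (fun _ : X => 0 : R) by apply: unit_fun_cst; rewrite ler01 lexx.
    have E m : expect m (fun x => `|\1_(@set0 X) x - 0|) = 0.
      by rewrite -[RHS](expect_cst m); congr expect; apply/funext => x; rewrite indic0 subrr normr0.
    split; rewrite ?E ?ltW//.
    by move=> x s s0; exists 1; split => // y _; rewrite subrr normr0.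
  have mT : measurable (\bigcup_k F k) by exact: bigcupT_measurable.
  have uT := unit_fun_indic (R := R) mT.
  have uU n := unit_fun_indic (R := R) (mU n).
  have lim m : (fun n => expect m (fun x => `|\1_(\bigcup_k F k) x - \1_(U n) x|)) @ \oo
      --> (0 : R).
    rewrite -(expect_cst m 0); apply: expect_cvg.
    + by move=> n; exact: unit_fun_dist.
    + by apply: unit_fun_cst; rewrite ler01 lexx.
    + move=> x; apply: cvg_near_cst; have [[k _ Fkx]|Fx] := pselect ((\bigcup_k F k) x).
        exists k.+1 => // n /= kn; rewrite !indicE !mem_set ?subrr ?normr0//; last by exists k.
        by rewrite /U -bigcup_mkord; exists k.
      apply: nearW => n; rewrite !indicE !memNset ?subrr ?normr0//.
      by rewrite /U -bigcup_mkord => -[k _ Fkx]; apply: Fx; exists k.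
  have e20 : 0 < e / 2 by rewrite divr_gt0.
  have [N1 h1] := (cvgn_dist _ _).1 (lim m1) _ e20.
  have [N2 h2] := (cvgn_dist _ _).1 (lim m2) _ e20.
  have [g [cg ug g1 g2]] := aU (maxn N1 N2) _ e20.
  exists g; split => //; rewrite (splitr e).
  + apply: (le_trans (expect_dist_trans m1 uT (uU (maxn N1 N2)) ug)); apply: lerD => //.
    by move: (h1 _ (leq_maxl N1 N2)); rewrite subr0; exact: le_trans (ler_norm _).
  + apply: (le_trans (expect_dist_trans m2 uT (uU (maxn N1 N2)) ug)); apply: lerD => //.
    by move: (h2 _ (leq_maxr N1 N2)); rewrite subr0; exact: le_trans (ler_norm _).
Qed.
End Density.

(** * Baire category relative to a subset *)

Section Baire.
Context {R : realType} {X : choiceType} (rho : X -> X -> R).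
Hypothesis rho_polish : polish rho.

(** If no such ball exists, closed balls centred in [Y] can be nested so that the n-th step leaves
    [F n]. The limit of the centres may fall outside [Y], but the sets [F n] cover all of [X], so it
    still gives a contradiction. *)
Lemma baire_relative (F : nat -> set X) (Y : set X) z : Y z ->
  (forall n, ropen rho (~` F n)) -> (forall x, exists n, F n x) ->
  exists n x (r : R), [/\ 0 < r, Y x & forall y, Y y -> rball rho x r y -> F n y].
Proof.
move=> Yz oF covF; apply: contrapT => noball.
have [[rho0 rhoE rhoC rhoD] compl _] := rho_polish.
have step (p : nat * (X * R)) : exists q : X * R, Y p.2.1 -> 0 < p.2.2 ->
    [/\ Y q.1, 0 < q.2, q.2 <= p.1.+1%:R^-1 &
        forall w, rho q.1 w <= q.2 -> rho p.2.1 w <= p.2.2 /\ ~ F p.1 w].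
  case: p => n [x r] /=.
  have [Yx|nYx] := pselect (Y x); last by exists (x, r).
  have [r0|r0] := ltP 0 r; last by exists (x, r) => _; rewrite ltNge r0.
  have [y [Yy xy nFy]] : exists y, [/\ Y y, rho x y < r & ~ F n y].
    apply: contrapT => h; apply: noball; exists n, x, r; split => // y Yy xy.
    by apply: contrapT => nFy; apply: h; exists y.
  have [s [s0 sF]] := oF n y nFy.
  have rxy : 0 < r - rho x y by rewrite subr_gt0.
  (* The three bounds on the new radius: s/2 makes the closed ball miss [F n], [r - rho x y] keeps
     it in the previous ball, and 1/(n+1) makes the centres Cauchy. *)
  exists (y, Num.min (Num.min (s / 2) (r - rho x y)) n.+1%:R^-1) => _ _ /=.
  split => //.
  - by rewrite !lt_min divr_gt0// rxy invr_gt0 ltr0n.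
  - by rewrite ge_min lexx orbT.
  - move=> w; rewrite !le_min => /andP[/andP[ws wr] _]; split.
      by have := rhoD x y w; lra.
    by apply: sF; rewrite /rball/=; lra.
have [q hq] := choice step.
pose u := fix u n : X * R := if n is k.+1 then q (k, u k) else (z, 1).
have uP n : Y (u n).1 /\ 0 < (u n).2.
  elim: n => [|n [IY I0]]; first by split => //=.
  by have [] := hq (n, u n) IY I0.
have uS n w : rho (u n.+1).1 w <= (u n.+1).2 -> rho (u n).1 w <= (u n).2 /\ ~ F n w.
  by have [IY I0] := uP n; have [_ _ _] := hq (n, u n) IY I0; apply.
have ur n : (u n.+1).2 <= n.+1%:R^-1.
  by have [IY I0] := uP n; have [] := hq (n, u n) IY I0.
have nest n k w : rho (u (k + n)%N).1 w <= (u (k + n)%N).2 -> rho (u n).1 w <= (u n).2.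
  elim: k w => [//|k IH] w; rewrite addSn => /uS[h _]; exact: IH.
have cent n m : (n <= m)%N -> rho (u n).1 (u m).1 <= (u n).2.
  move=> nm; apply: (nest n (m - n)%N); rewrite subnK//.
  by rewrite (rhoE _ _).2// ltW//; case: (uP m).
have [|l hl] := compl (fun n => (u n).1).
  move=> e; move: (e : R) => {}e e0; have [N hN] : exists N : nat, N.+1%:R^-1 < e / 2 :> R.
    have [N _ hN] := near_infty_natSinv_lt (PosNum (divr_gt0 e0 (ltr0n R 2))).
    by exists N; exact: (hN N (leqnn _)).
  exists N.+1 => m n Nm Nn.
  rewrite (splitr e); apply: le_lt_trans (rhoD _ (u N.+1).1 _) _.
  rewrite (rhoC _ (u N.+1).1).
  by apply: ltrD; apply: le_lt_trans (cent _ _ _) (le_lt_trans (ur N) hN).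
have lim n : rho (u n).1 l <= (u n).2.
  apply/ler_addgt0Pr => e e0; have [N hN] := hl e e0.
  have := hN _ (leq_maxl N n); have := cent _ _ (leq_maxr N n).
  by have := rhoD (u n).1 (u (maxn N n)).1 l; lra.
by have [n Fl] := covF l; have [_] := uS n l (lim n.+1).
Qed.
End Baire.

(** * Common part and excesses of two probabilities *)

Section Hahn.
Context {R : realType} {d : measure_display} {X : measurableType d}.
Implicit Types (f : X -> R) (A : set X).

(* [m] is the minimum of [m1] and [m2], [n1] and [n2] are the excesses of [m1] and [m2] over it *)
Lemma hahn_split (m1 m2 : probability X R) : exists (P : set X) (m : {measure set X -> \bar R})
    (n1 n2 : {finite_measure set X -> \bar R}),
  [/\ measurable P,
      forall A, measurable A -> m1 A = (m A + n1 A)%E,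
      forall A, measurable A -> m2 A = (m A + n2 A)%E,
      n1 setT = (m1 P - m2 P)%E & n2 setT = (m1 P - m2 P)%E].
Proof.
pose nu : {charge set X -> \bar R} := cadd (charge_of_finite_measure m1) (cscale (-1) (charge_of_finite_measure m2)).
have nuE A : nu A = (m1 A - m2 A)%E.
  by rewrite /nu/= /cadd/= cscaleN1.
have [P [N nuPN]] := Hahn_decomposition nu.
have [[mP posP] [mN negN] PNT PN0] := nuPN.
have fin m A : measurable A -> (m : probability X R) A \is a fin_num.
  by move=> mA; exact: fin_num_measure.
have split_PN (m : probability X R) A : measurable A -> m A = (m (A `&` P) + m (A `&` N))%E.
  move=> mA; rewrite -[in LHS](setIT A) -PNT setIUr measureU//; [exact: measurableI..|].
  by rewrite setIACA PN0 setI0.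
(* On the positive set [P] of [m1 - m2] the smaller measure is [m2], on [N] it is [m1]. *)
pose m : {measure set X -> \bar R} := measure_add (mrestr m1 mN) (mrestr m2 mP).
have mE A : m A = (m1 (A `&` N) + m2 (A `&` P))%E.
  exact: measure_addE.
have n1E A : measurable A -> jordan_pos nuPN A = (m1 (A `&` P) - m2 (A `&` P))%E.
  by move=> mA; rewrite jordan_posE cjordan_posE /crestr0 mem_set// /crestr nuE.
have n2E A : measurable A -> jordan_neg nuPN A = (m2 (A `&` N) - m1 (A `&` N))%E.
  move=> mA; rewrite jordan_negE cjordan_negE /crestr0 mem_set// /crestr nuE.
  rewrite fin_num_oppeB; first by rewrite addeC.
  by apply: fin; exact: measurableI.
exists P, m, (jordan_pos nuPN), (jordan_neg nuPN); split => //.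
- move=> A mA; rewrite mE [X in _ = (_ + X)%E]n1E// split_PN//.
  have := fin m2 _ (measurableI _ _ mA mP).
  have := fin m1 _ (measurableI _ _ mA mP); have := fin m1 _ (measurableI _ _ mA mN).
  move=> /fineK<- /fineK<- /fineK<-; rewrite -?EFinD -?EFinB -?EFinD; congr (_%:E); lra.
- move=> A mA; rewrite mE [X in _ = (_ + X)%E]n2E// split_PN//.
  have := fin m2 _ (measurableI _ _ mA mP); have := fin m2 _ (measurableI _ _ mA mN).
  have := fin m1 _ (measurableI _ _ mA mN).
  move=> /fineK<- /fineK<- /fineK<-; rewrite -?EFinD -?EFinB -?EFinD; congr (_%:E); lra.
- by rewrite [LHS]n1E// setTI.
(* The two excesses have equal mass because [m1] and [m2] both have mass 1. *)
- rewrite [LHS]n2E// !setTI; have := split_PN m1 _ measurableT; have := split_PN m2 _ measurableT.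
  rewrite !setTI !probability_setT.
  move: (fin m1 _ mP) (fin m2 _ mP) (fin m1 _ mN) (fin m2 _ mN).
  move=> /fineK<- /fineK<- /fineK<- /fineK<-; rewrite -?EFinD -?EFinB => -[+] -[+].
  by move=> h1 h2; congr (_%:E); lra.
Qed.

(** After the common part cancels, only the excess of [m1] can raise its integral. As [f] is at most
    1, this contributes at most the mass [m1 P - m2 P], which the hypothesis bounds at the single
    set [P]. *)
Lemma expect_le_sets (m1 m2 : probability X R) (e : R) f : unit_fun f ->
  (forall A, measurable A -> (m1 A <= m2 A + e%:E)%E) -> expect m1 f <= expect m2 f + e.
Proof.
move=> uf h; have [P [m [n1 [n2 [mP E1 E2 nT _]]]]] := hahn_split m1 m2.
have [mf f01] := uf.
have mf' : measurable_fun setT (fun x => (f x)%:E) by exact/measurable_EFinP.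
have f0 x : setT x -> (0 <= (f x)%:E)%E by rewrite lee_fin; case/andP: (f01 x).
rewrite -lee_fin EFinD -!expectE//.
rewrite (@eq_measure_integral _ _ _ _ (measure_add m n1) m1); last first.
  by move=> A mA _; rewrite -[RHS]/(measure_add m n1 A) [RHS]measure_addE -E1.
rewrite (@eq_measure_integral _ _ _ _ (measure_add m n2) m2); last first.
  by move=> A mA _; rewrite -[RHS]/(measure_add m n2 A) [RHS]measure_addE -E2.
rewrite !ge0_integral_measure_add// -[leRHS]addeA; apply: leeD => //.
apply: (@le_trans _ _ (n1 setT)).
  rewrite -[leRHS]mul1e -integral_cst//; apply: ge0_le_integral => //.
  by move=> x _; rewrite lee_fin; case/andP: (f01 x).
apply: (@le_trans _ _ e%:E); last by rewrite leeDr// integral_ge0.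
rewrite nT leeBlDr ?fin_num_measure// addeC; exact: h.
Qed.
End Hahn.

(** * Convergence of time averages in total variation *)

Section Expectation2.
Context {R : realType} {d : measure_display} {X : measurableType d}.
Implicit Types (m : probability X R) (f g : X -> R) (A B : set X).

Lemma le_expect_indic m A B : measurable A -> measurable B -> A `<=` B ->
  expect m \1_A <= expect m \1_B.
Proof.
move=> mA mB AB; apply: le_expect; [exact: unit_fun_indic..|] => x.
by rewrite !indicE ler_nat; case: (boolP (x \in A)) => // /set_mem/AB/mem_set ->.
Qed.

Lemma expectZ m f (c : R) : unit_fun f -> expect m (fun x => c * f x) = c * expect m f.
Proof. by move=> uf; apply: RintegralZl => //; exact: unit_fun_integrable. Qed.

Lemma unit_funZ f (c : R) : 0 <= c <= 1 -> unit_fun f -> unit_fun (fun x => c * f x).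
Proof. by move=> c01 uf; apply: unit_funM => //; exact: unit_fun_cst. Qed.

Lemma expect_lin m f g (a b : R) : unit_fun f -> unit_fun g ->
  expect m (fun x => a * f x + b * g x) = a * expect m f + b * expect m g.
Proof.
move=> uf ug; have [if_ ig] := (unit_fun_integrable m uf, unit_fun_integrable m ug).
rewrite expectD ?expectZ//.
- exact: (integrableZl measurableT a if_).
- exact: (integrableZl measurableT b ig).
Qed.

Lemma expect_indicC m A : measurable A -> expect m \1_(~` A) = 1 - expect m \1_A.
Proof.
move=> mA; rewrite -expect1B; last exact: unit_fun_indic.
congr expect; apply/funext => x; rewrite !indicE in_setC.
by case: (_ \in _); rewrite ?subrr ?subr0.
Qed.

Lemma expect_indicU m A B : measurable A -> measurable B -> A `&` B = set0 ->
  expect m \1_(A `|` B) = expect m \1_A + expect m \1_B.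
Proof.
move=> mA mB AB; apply: EFin_inj.
by rewrite EFinD !expect_indic ?measureU//; exact: measurableU.
Qed.

Lemma expect_indic_bigcup m (F : nat -> set X) : (forall n, measurable (F n)) ->
  (fun n => expect m \1_(\big[setU/set0]_(i < n) F i)) @ \oo -->
  expect m \1_(\bigcup_n F n).
Proof.
move=> mF; apply: expect_cvg.
- by move=> n; apply: unit_fun_indic; exact: bigsetU_measurable.
- by apply: unit_fun_indic; exact: bigcupT_measurable.
- move=> x; apply: cvg_near_cst.
  have [[k _ Fkx]|Fx] := pselect ((\bigcup_k F k) x).
    exists k.+1 => // n /= kn; rewrite !indicE !mem_set//; first by exists k.
    by rewrite -bigcup_mkord; exists k.
  apply: nearW => n; rewrite !indicE !memNset//.
  by rewrite -bigcup_mkord => -[k _ Fkx]; apply: Fx; exists k.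
Qed.

(** Completeness of probabilities in total variation. The setwise limit is finitely additive, and
    uniformity over sets lets one [p K] transfer its countable additivity. *)
Lemma uniform_cauchy_probability (p : nat -> probability X R) :
  (forall e : R, 0 < e -> exists N, forall m n : nat, (N <= m)%N -> (N <= n)%N ->
     forall A, measurable A -> `|expect (p m) \1_A - expect (p n) \1_A| <= e) ->
  exists mu : probability X R, forall e : R, 0 < e -> exists N, forall n, (N <= n)%N ->
     forall A, measurable A -> `|expect (p n) \1_A - expect mu \1_A| <= e.
Proof.
move=> cau.
pose l A : R := lim ((fun n => expect (p n) \1_A) @ \oo).
have cvgl A : measurable A -> (fun n => expect (p n) \1_A) @ \oo --> l A.
  move=> mA; apply/cauchy_cvgP/cauchy_exP => e e0.
  have [|N hN] := cau (e / 2); first by rewrite divr_gt0.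
  exists (expect (p N) \1_A); exists N => // n Nn /=.
  rewrite -ball_normE/=; have := hN _ _ (leqnn N) Nn A mA; lra.
have unif (e : R) : 0 < e -> exists N, forall n, (N <= n)%N ->
     forall A, measurable A -> `|expect (p n) \1_A - l A| <= e.
  move=> e0; have e20 : 0 < e / 2 by rewrite divr_gt0.
  have [N hN] := cau _ e20; exists N => n Nn A mA.
  have [K hK] := (cvgn_dist _ _).1 (cvgl A mA) _ e20.
  have := hK _ (leq_maxl K N); have := hN _ _ Nn (leq_maxr K N) A mA.
  rewrite !ler_norml; lra.
have l0 : l set0 = 0.
  rewrite /l (_ : (fun _ => _) = (fun=> 0)) ?lim_cst//; apply/funext => n.
  by rewrite -(expect_cst (p n) 0); congr expect; apply/funext => x; rewrite indic0.
have lT : l setT = 1.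
  rewrite /l (_ : (fun _ => _) = (fun=> 1)) ?lim_cst//; apply/funext => n.
  by rewrite -(expect_cst (p n) 1); congr expect; apply/funext => x; rewrite indicT.
have l_ge0 A : measurable A -> 0 <= l A.
  move=> mA; apply: limr_ge; first by apply/cvg_ex; exists (l A); exact: cvgl.
  by apply: nearW => n; apply: expect_ge0 => x; rewrite indicE ler0n.
have lU A B : measurable A -> measurable B -> A `&` B = set0 -> l (A `|` B) = l A + l B.
  move=> mA mB AB; rewrite {1}/l; apply/cvg_lim => //.
  rewrite (_ : (fun _ => _) = (fun n => expect (p n) \1_A + expect (p n) \1_B)).
    by apply: cvgD; exact: cvgl.
  by apply/funext => n; exact: expect_indicU.
(* A measure must be nonnegative on every set, whereas [l] is controlled on measurable sets only;
   hence the value 0 elsewhere. *)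
pose m0 (A : set X) : \bar R := if pselect (measurable A) then (l A)%:E else 0%E.
have m0E A : measurable A -> m0 A = (l A)%:E by rewrite /m0; case: pselect.
have m00 : m0 set0 = 0%E by rewrite m0E// l0.
have m0_ge0 A : (0 <= m0 A)%E.
  by rewrite /m0; case: pselect => // mA; rewrite lee_fin; exact: l_ge0.
have m0_sigma : semi_sigma_additive m0.
  move=> F mF tF mUF; rewrite m0E//.
  have lsum n : (\sum_(0 <= i < n) m0 (F i))%E = (l (\big[setU/set0]_(i < n) F i))%:E.
    elim: n => [|n IH]; first by rewrite big_geq// big_ord0 l0.
    rewrite big_nat_recr//= IH m0E// -EFinD big_ord_recr/= lU//.
      exact: bigsetU_measurable.
    rewrite -bigcup_mkord; apply/seteqP; split => // x [[k /= kn Fkx] Fnx].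
    by move/trivIsetP: tF => /(_ k n I I (negbT (ltn_eqF kn))) h; have : (F k `&` F n) x by []; rewrite h.
  rewrite (_ : (fun n => _) = (fun n => (l (\big[setU/set0]_(i < n) F i))%:E)); last first.
    by apply/funext => n; exact: lsum.
  apply: cvg_EFin; first exact: nearW.
  apply/cvgn_dist => e e0; have e30 : 0 < e / 3 by rewrite divr_gt0.
  have [K hK] := unif _ e30; have {}hK := hK _ (leqnn K).
  have [N hN] := (cvgn_dist _ _).1 (expect_indic_bigcup (m := p K) mF) _ e30.
  exists N => n /hN; have := hK _ mUF.
  have := hK _ (bigsetU_measurable (index_enum 'I_n) (fun i _ => mF i) (P := xpredT)).
  rewrite /= !ler_norml; lra.
pose mu1 : measure _ _ := HB.pack m0 (isMeasure.Build _ _ _ m0 m00 m0_ge0 m0_sigma).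
have mu1T : mu1 setT = 1%E by rewrite /mu1/= m0E// lT.
pose mu : probability X R := HB.pack m0 mu1 (Measure_isProbability.Build _ _ _ mu1 mu1T).
exists mu => e e0; have [N hN] := unif e e0; exists N => n Nn A mA.
suff -> : expect mu \1_A = l A by exact: hN.
by apply: EFin_inj; rewrite expect_indic// -m0E.
Qed.
End Expectation2.

(** * From local merging and recurrence to convergence of all averages *)

Section Ergodic.
Context {R : realType} {d : measure_display} {X : measurableType d} (rho : X -> X -> R).
Hypothesis rho_polish : polish rho.
Hypothesis borel : @measurable d X = <<s ropen rho >>.

Let rho_metric : is_metric rho. Proof. by case: rho_polish. Qed.

Variable Q : R -> X -> probability X R.
Hypothesis measurable_Q : forall (T : R) A, 0 < T -> measurable A ->
  measurable_fun setT (fun y => Q T y A).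
(** The two shift estimates differ in the order of the runs: here the run of length [T] comes first,
    in [Q_shift2] it comes last. The first drives merging; the second drives recurrence, domination
    and the Cauchy estimate. *)
Hypothesis Q_shift1 : forall (S T : R) x f, 0 < S -> 0 < T -> unit_fun f ->
  `|expect (Q T x) (fun y => expect (Q S y) f) - expect (Q S x) f| <= T / S.
Hypothesis Q_shift2 : forall (S T : R) x f, 0 < S -> 0 < T -> unit_fun f ->
  `|expect (Q S x) (fun y => expect (Q T y) f) - expect (Q S x) f| <= T / S.
Hypothesis Q_feller : forall (T : R) g, 0 < T -> rcontinuous rho g -> unit_fun g ->
  rcontinuous rho (fun y => expect (Q T y) g).

Variable z : X.
Hypothesis Q_ucec : forall e : R, 0 < e -> exists2 r : R, 0 < r &
  forall y, rball rho z r y -> exists2 T0 : R, 0 < T0 &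
  forall T, T0 <= T -> forall f, unit_fun f -> `|expect (Q T y) f - expect (Q T z) f| <= e.
Hypothesis Q_c2 : forall r : R, 0 < r -> exists2 c : R, 0 < c &
  forall x (T0 : R), exists T, [/\ T0 <= T, 0 < T & c <= expect (Q T x) \1_(rball rho z r)].

Let unitQ (T : R) f : 0 < T -> unit_fun f -> unit_fun (fun y => expect (Q T y) f).
Proof. by move=> T0; apply: unit_fun_expect => A mA; exact: measurable_Q. Qed.

Let mball x (r : R) : measurable (rball rho x r).
Proof. by apply: (ropen_measurable borel); exact: ropen_rball. Qed.

(** * Merging along one sequence of times and test functions *)

Section MergingSequence.
Variables (T_ : nat -> R) (f_ : nat -> X -> R).
Hypothesis T_ge : forall n, n.+1%:R <= T_ n.
Hypothesis unit_f : forall n, unit_fun (f_ n).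

Let T_gt0 n : 0 < T_ n. Proof. by rewrite (lt_le_trans _ (T_ge n)). Qed.

Let h n y := `|expect (Q (T_ n) y) (f_ n) - expect (Q (T_ n) z) (f_ n)|.

Let unit_h n : unit_fun (h n).
Proof.
apply: unit_fun_dist; first exact: unitQ.
apply: unit_fun_cst; rewrite expect_le1// expect_ge0// => x.
by case: (unit_f n) => _ /(_ x)/andP[].
Qed.

(** Inserting a first run of length [t] replaces the average from [x] by the mean over [Q t x] of
    averages from [y]; the constant taken at [z] then moves inside the mean and the absolute
    value. *)
Let h_shift n x (t : R) : 0 < t -> h n x <= t / T_ n + expect (Q t x) (h n).
Proof.
move=> t0; have uq := unitQ (T_gt0 n) (unit_f n).
have := Q_shift1 x (T_gt0 n) t0 (unit_f n).
have uc : unit_fun (fun _ : X => expect (Q (T_ n) z) (f_ n)).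
  apply: unit_fun_cst; rewrite expect_le1// expect_ge0// => y.
  by case: (unit_f n) => _ /(_ y)/andP[].
have := expect_dist (Q t x) uq uc; rewrite expect_cst /h => h1 h2.
by move: h1 h2; rewrite !ler_norml; lra.
Qed.

Let eventually_le (l : R) := forall y, exists N, forall n, (N <= n)%N -> h n y <= l.

(* One visit to a ball around [z] where [h] is eventually at most [e] improves any uniform bound. *)
Let improve (e : R) : 0 < e <= 1 -> exists2 a : R, 0 < a &
  forall l eta : R, 0 <= l <= 1 -> e <= l -> eventually_le l -> 0 < eta ->
  eventually_le (l - a * (l - e) + eta).
Proof.
move=> /andP[e0 e1]; have [r r0 hr] := Q_ucec e0; have [a a0 ha] := Q_c2 r0.
exists a => // l eta l01 el evl eta0 x; have [t [_ t0 at_]] := ha x 0.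
(* [b] is the eventual pointwise bound on [h]: [e] on the ball by Cesàro continuity, [l]
   elsewhere. *)
pose B := rball rho z r; pose b y : R := e * \1_B y + l * \1_(~` B) y.
have uB := unit_fun_indic (R := R) (mball z r).
have uC := unit_fun_indic (R := R) (measurableC (mball z r)).
have ub : unit_fun b.
  split; first by apply: measurable_funD; apply: measurable_funM => //; [case: uB|case: uC].
  by move=> y; rewrite /b !indicE in_setC; case: (_ \in _) => /=; lra.
(* [h n] need not converge, but [phi n] does: it is eventually equal to [b] at each point, from an
   index depending on the point. Dominated convergence then bounds the mean of [h n]. *)
pose phi n y := Num.max (h n y) (b y).
have uphi n : unit_fun (phi n).
  split; first by apply: measurable_maxr; [case: (unit_h n)|case: ub].
  by move=> y; have [_ /(_ y)] := unit_h n; have [_ /(_ y)] := ub; rewrite /phi; case: (leP (h n y) (b y)).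
have phib y : phi ^~ y @ \oo --> b y.
  apply: cvg_near_cst; have [By|nBy] := pselect (B y).
    have [T0 T00 hT0] := hr y By.
    exists (Num.bound T0) => // n /= Tn.
    apply/max_idPr; rewrite /b !indicE in_setC mem_set//= mulr1 mulr0 addr0.
    apply: hT0 => //; apply: le_trans (T_ge n); apply/ltW.
    by apply: lt_le_trans (archi_boundP (ltW T00)) _; rewrite ler_nat ltnW.
  have [N hN] := evl y.
  exists N => // n Nn; apply/max_idPr; rewrite /b !indicE in_setC memNset//= mulr0 mulr1 add0r.
  exact: hN.
(* The mean of [b] is [l] minus (l - e) times the mass of the ball, and this mass is at least
   [a]. *)
have eb : expect (Q t x) b <= l - a * (l - e).
  rewrite expect_lin// (expect_indicC _ (mball z r)).
  have : a * (l - e) <= expect (Q t x) \1_B * (l - e) by rewrite ler_wpM2r// subr_ge0.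
  lra.
have [|N hN] := (cvgn_dist _ _).1 (expect_cvg (m := Q t x) uphi ub phib) (eta / 2).
  by rewrite divr_gt0.
have [K hK] : exists K : nat, t * 2 / eta <= K%:R.
  by exists (Num.bound (t * 2 / eta)); apply/ltW/archi_boundP; rewrite divr_ge0 ?ltW// mulr_gt0.
exists (maxn N K) => n; rewrite geq_max => /andP[Nn Kn].
apply: (le_trans (h_shift n x t0)).
have h1 : t / T_ n <= eta / 2.
  rewrite ler_pdivrMr// mulrAC ler_pdivlMr// -ler_pdivrMl// mulrC (le_trans hK)//.
  by rewrite (le_trans _ (T_ge n))// ler_nat ltnW.
have h2 : expect (Q t x) (h n) <= expect (Q t x) (phi n).
  by apply: le_expect => // y; rewrite /phi le_max lexx.
have := hN n Nn; rewrite ler_norml; lra.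
Qed.

(** The infimum of the eventual bounds must vanish: the gain [a] in [improve] depends on the
    tolerance but not on the current bound, so a positive infimum could be improved past itself. *)
Lemma merging_sequence x (e : R) : 0 < e -> exists N, forall n, (N <= n)%N ->
  `|expect (Q (T_ n) x) (f_ n) - expect (Q (T_ n) z) (f_ n)| <= e.
Proof.
pose S : set R := [set l | 0 <= l <= 1 /\ eventually_le l].
have S1 : S 1.
  split; first by rewrite ler01 lexx.
  by move=> y; exists 0%N => n _; case: (unit_h n) => _ /(_ y)/andP[].
have lbS : lbound S 0 by move=> l [/andP[]].
have infS : has_inf S by split; [exists 1|exists 0].
have L0 : 0 <= inf S by apply: lb_le_inf; first exists 1.
wlog e1 : e / e <= 1 => [wl e0|e0].
  have [le1|le1] := leP e 1; first exact: wl.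
  by have [|N hN] := wl 1 (lexx _); [exact: ltr01|exists N => n /hN; move/le_trans; apply; exact: ltW].
suff Le : inf S <= e / 2.
  have e20 : 0 < e / 2 by rewrite divr_gt0.
  have [l [_ hl] le] := inf_adherent e20 infS.
  have [N hN] := hl x; exists N => n Nn; apply: le_trans (hN n Nn) _.
  by apply/ltW; apply: lt_le_trans le _; rewrite [leRHS]splitr lerD2r.
rewrite leNgt; apply/negP => Le.
have e201 : 0 < e / 2 <= 1 by lra.
have [a a0 ha] := improve e201.
(* One improvement gains at least [g]. Spending g/4 on the choice of [l] near the infimum and g/4 on
   the error [eta] leaves a bound strictly below the infimum. *)
pose g := a * (inf S - e / 2).
have g0 : 0 < g by rewrite mulr_gt0// subr_gt0.
have g40 : 0 < g / 4 by rewrite divr_gt0.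
have [l [l01 hl] lL] := inf_adherent g40 infS.
have Ll : inf S <= l by apply: ge_inf => //; exists 0.
have evb := ha l (g / 4) l01 (le_trans (ltW Le) Ll) hl g40.
have agl : g <= a * (l - e / 2) by rewrite ler_pM2l// lerD2r.
suff : S (l - a * (l - e / 2) + g / 4).
  by move=> /(ge_inf (ex_intro _ 0 lbS)); lra.
(* The new bound is nonnegative because it dominates some [h N z]. *)
split => //; have [N hN] := evb z; have := hN N (leqnn _).
have := normr_ge0 (expect (Q (T_ N) z) (f_ N) - expect (Q (T_ N) z) (f_ N)).
by rewrite -/(h N z); have /andP[_ l1] := l01; lra.
Qed.
End MergingSequence.

(** A supremum over all test functions need not be measurable in the starting point. A failure is
    therefore recorded as a sequence of bad pairs (T, f) with times tending to infinity, to which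
    the sequential version applies. *)
Lemma merging x (e : R) : 0 < e -> exists2 T0 : R, 0 < T0 &
  forall T, T0 <= T -> forall f, unit_fun f -> `|expect (Q T x) f - expect (Q T z) f| <= e.
Proof.
move=> e0; apply: contrapT => nT.
have bad (n : nat) : exists p : R * (X -> R), [/\ n.+1%:R <= p.1, unit_fun p.2 &
    e < `|expect (Q p.1 x) p.2 - expect (Q p.1 z) p.2|].
  apply: contrapT => np; apply: nT; exists n.+1%:R => [|T nT f uf]; first by rewrite ltr0n.
  by rewrite leNgt; apply/negP => lt; apply: np; exists (T, f).
have [p hp] := choice bad.
have [||N hN] := @merging_sequence (fun n => (p n).1) (fun n => (p n).2) _ _ x e e0.
- by move=> n; case: (hp n).
- by move=> n; case: (hp n).
by have [_ _] := hp N; rewrite ltNge hN.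
Qed.

(** Continuous test functions only, so that by the Feller property each condition is closed in [y].
    Starting at [N.+1] keeps the times positive. *)
Let F (e : R) (N : nat) : set X := [set y | forall T : R, N.+1%:R <= T -> forall g,
  rcontinuous rho g -> unit_fun g -> `|expect (Q T y) g - expect (Q T z) g| <= e].

Let open_F (e : R) N : ropen rho (~` F e N).
Proof.
move=> y nF; have [T [NT [g [cg ug lt]]]] : exists T : R, N.+1%:R <= T /\ exists g,
    [/\ rcontinuous rho g, unit_fun g & e < `|expect (Q T y) g - expect (Q T z) g|].
  apply: contrapT => h; apply: nF => T NT g cg ug; rewrite leNgt; apply/negP => lt.
  by apply: h; exists T; split => //; exists g.
have T0 : 0 < T by rewrite (lt_le_trans _ NT).
have [|r [r0 hr]] := @Q_feller T g T0 cg ug y (`|expect (Q T y) g - expect (Q T z) g| - e).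
  by rewrite subr_gt0.
exists r; split => // w /hr lw Fw; have := Fw T NT g cg ug.
have := ler_distD (expect (Q T w) g) (expect (Q T y) g) (expect (Q T z) g).
by move: lw; rewrite (distrC (expect (Q T w) g) (expect (Q T y) g)); lra.
Qed.

Let cover_F (e : R) x : 0 < e -> exists N, F e N x.
Proof.
move=> e0; have [T0 T00 hT] := merging x e0.
exists (Num.bound T0) => T NT g _ ug; apply: hT => //.
apply/ltW; apply: lt_le_trans (archi_boundP (ltW T00)) _.
by apply: le_trans NT; rewrite ler_nat.
Qed.

(** Positivity of the upper limit of $q_T(A)$, written out with a lower bound [c]. *)
Let recurrent (A : set X) := exists2 c : R, 0 < c & forall T0 : R, exists T,
  [/\ T0 <= T, 0 < T & c <= expect (Q T z) \1_A].

Let recurrentS A B : measurable A -> measurable B -> A `<=` B -> recurrent A -> recurrent B.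
Proof.
move=> mA mB AB [c c0 hc]; exists c => // T0; have [T [T0T T_0 cT]] := hc T0.
by exists T; split => //; apply: le_trans cT _; exact: le_expect_indic.
Qed.

(* Feller: a ball charged by [Q t z] is charged from all points near [z], and these recur. *)
Let recurrent_ball w (r t : R) : 0 < t -> 0 < expect (Q t z) \1_(rball rho w r) ->
  recurrent (rball rho w r).
Proof.
move=> t0 pos; have [g [cg ug gB gcvg]] := ropen_approx_unit rho_metric borel (@ropen_rball _ _ _ _ rho_metric w r).
have uB := unit_fun_indic (R := R) (mball w r).
have [n gn] : exists n, 0 < expect (Q t z) (g n).
  have p20 : 0 < expect (Q t z) \1_(rball rho w r) / 2 by rewrite divr_gt0.
  have [N hN] := (cvgn_dist _ _).1 (expect_cvg (m := Q t z) ug uB gcvg) _ p20.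
  by exists N; have := hN N (leqnn _); rewrite ler_norml; lra.
(* Halving leaves room for continuity: near [z] the mean of [g n] after a run of length [t] stays
   above [c]. *)
pose c := expect (Q t z) (g n) / 2.
have c0 : 0 < c by rewrite divr_gt0.
have c1 : c <= 1 by have := expect_le1 (Q t z) (ug n); rewrite /c; lra.
have [s [s0 hs]] := @Q_feller t (g n) t0 (cg n) (ug n) z c c0.
have [a a0 ha] := Q_c2 s0.
exists (c * a / 2); first by rewrite divr_gt0// mulr_gt0.
(* The ball around [z] has mass at least [a] at time [T], giving [c * a] after the extra run. The
   bound 2t/(ca) makes the shift error at most half of this. *)
move=> T0; have [T [+ T_0 aT]] := ha z (Num.max T0 (2 * t / (c * a))).
rewrite ge_max => /andP[T0T tT]; exists T; split => //.
have tT' : t / T <= c * a / 2.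
  move: tT; rewrite ler_pdivrMr ?mulr_gt0// => h.
  by rewrite ler_pdivrMr// mulrAC ler_pdivlMr//; lra.
have h1 := Q_shift2 z T_0 t0 (ug n).
have h2 : c * expect (Q T z) \1_(rball rho z s) <=
    expect (Q T z) (fun y => expect (Q t y) (g n)).
  rewrite -expectZ; last exact: unit_fun_indic.
  apply: le_expect.
  - by apply: unit_funZ; [rewrite ltW|exact: unit_fun_indic].
  - exact: unitQ.
  - move=> y; rewrite indicE; case: (boolP (y \in _)) => [/set_mem/hs|_].
      by rewrite mulr1 ltr_norml /c; lra.
    by rewrite mulr0; apply: expect_ge0 => v; case: (ug n) => _ /(_ v)/andP[].
have h3 : expect (Q T z) (g n) <= expect (Q T z) \1_(rball rho w r) by exact: le_expect.
have h4 : c * a <= c * expect (Q T z) \1_(rball rho z s) by rewrite ler_pM2l.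
by move: h1; rewrite ler_norml; lra.
Qed.

Let Y : set X := [set y | forall r : R, 0 < r -> recurrent (rball rho y r)].

Let Yz : Y z.
Proof. by move=> r /Q_c2[c c0 hc]; exists c. Qed.

(** The complement of [Y] is the union of the non-recurrent balls with centre in a countable dense
    set and radius 1/(k+1). This gives measurability, and by [recurrent_ball] no [Q T z] charges any
    of these balls. *)
Let Y_full : measurable Y /\ forall T, 0 < T -> expect (Q T z) \1_Y = 1.
Proof.
have [_ _ [D denseD]] := rho_polish; have [rho0 rhoE rhoC rhoD] := rho_metric.
pose G n k := if pselect (recurrent (rball rho (D n) k.+1%:R^-1)) then set0
  else rball rho (D n) k.+1%:R^-1.
have mG n k : measurable (G n k) by rewrite /G; case: pselect => ?; [exact: measurable0|exact: mball].
have YE : ~` Y = \bigcup_n \bigcup_k G n k.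
  apply/seteqP; split => y.
    move=> /existsNP[r /not_implyP[r0 nrec]].
    have [k _ hk] := near_infty_natSinv_lt (PosNum (divr_gt0 r0 (ltr0n R 2))).
    have {}hk : k.+1%:R^-1 < r / 2 :> R by exact: (hk k (leqnn _)).
    have [|n hn] := denseD y (k.+1%:R^-1 : R); first by rewrite invr_gt0 ltr0n.
    exists n => //; exists k => //; rewrite /G; case: pselect => [rec|?]; last by rewrite /rball/= rhoC.
    apply: nrec; apply: recurrentS rec => // w; rewrite /rball/= => Dw.
    apply: le_lt_trans (rhoD y (D n) w) _; rewrite (splitr r).
    by apply: ltrD; apply: lt_trans hk.
  move=> [n _ [k _]]; rewrite /G; case: pselect => [//|nrec] /= By Yy.
  have [s [s0 sub]] := ropen_rball rho_metric By.
  by apply: nrec; exact: recurrentS (Yy s s0).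
have mYC : measurable (~` Y) by rewrite YE; do 2 apply: bigcupT_measurable => ?.
have mY : measurable Y by rewrite -(setCK Y); exact: measurableC.
split => // T T0; suff : expect (Q T z) \1_(~` Y) = 0 by rewrite expect_indicC//; lra.
apply: EFin_inj; rewrite expect_indic//; apply/negligibleP => //; rewrite YE.
apply: negligible_bigcup => n; apply: negligible_bigcup => k; apply/negligibleP => //.
apply: etrans (esym (expect_indic _ (mG n k))) _; rewrite /G; case: pselect => [?|nrec].
  by rewrite expect_indic// measure0.
congr (_%:E); apply/eqP; rewrite eq_le expect_ge0 ?andbT; last first.
  by move=> x; rewrite indicE ler0n.
by rewrite leNgt; apply/negP => /(recurrent_ball T0).
Qed.

(* Restarting from a recurrent ball on which all points merge with [z] uniformly in time, the
   averages at time [T] started from [z] are, up to [e], dominated by those at times [S >> T]. *)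
Let domination (e : R) : 0 < e -> exists (N gam : R) (P : R -> Prop), [/\ 0 < N, 0 < gam,
  forall T0, exists S, [/\ T0 <= S, 0 < S & P S] &
  forall S T A, 0 < S -> P S -> N <= T -> measurable A ->
    gam * (expect (Q T z) \1_A - e) <= expect (Q S z) \1_A + T / S].
Proof.
move=> e0.
have [N [x0 [r [r0 Yx0 hF]]]] :=
  baire_relative rho_polish Yz (@open_F e) (fun x => cover_F x e0).
have [gam gam0 hgam] := Yx0 r r0; have [mY QY] := Y_full.
(* Recurrence gives the lower bound [gam] only along an unbounded set of times; [P] singles these
   out. *)
exists N.+1%:R, gam, (fun S => gam <= expect (Q S z) \1_(rball rho x0 r)); split => //.
move=> S T A S0 gS NT mA; have T0 : 0 < T by rewrite (lt_le_trans _ NT).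
(* Uniform merging is known only at points of [Y]; intersecting costs no mass, since [Y] has full
   measure. *)
pose C := rball rho x0 r `&` Y.
have mC : measurable C by exact: measurableI.
have gC : gam <= expect (Q S z) \1_C.
  have := expect_indicC (Q S z) mY; rewrite QY// subrr => YC0.
  apply: le_trans gS _; rewrite -[leRHS]addr0 -YC0 -expect_indicU//.
  - apply: le_expect_indic => //; first by apply: measurableU => //; exact: measurableC.
    by move=> y By; have [Yy|nYy] := pselect (Y y); [left|right].
  - exact: measurableC.
  - by apply/seteqP; split => // y [[_ ?]].
have contg g : rcontinuous rho g -> unit_fun g ->
    gam * (expect (Q T z) g - e) <= expect (Q S z) g + T / S.
  move=> cg ug; have g0 : 0 <= expect (Q S z) g.
    by apply: expect_ge0 => v; case: ug => _ /(_ v)/andP[].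
  have TS0 : 0 <= T / S by rewrite divr_ge0 ?ltW.
  (* If the mean is at most [e] the left side is nonpositive. Otherwise the mean minus [e] is a
     constant in [0,1] that bounds the average from below at every point of [C]. *)
  have [le|lt] := leP (expect (Q T z) g) e.
    apply: (@le_trans _ _ 0); last by rewrite addr_ge0.
    by apply: mulr_ge0_le0; [exact: ltW|rewrite subr_le0].
  have h1 := Q_shift2 z S0 T0 ug.
  have ce0 : 0 <= expect (Q T z) g - e <= 1.
    by have := expect_le1 (Q T z) ug; lra.
  have h2 : (expect (Q T z) g - e) * expect (Q S z) \1_C <=
      expect (Q S z) (fun y => expect (Q T y) g).
    rewrite -expectZ; last exact: unit_fun_indic.
    apply: le_expect; [by apply: unit_funZ => //; exact: unit_fun_indic|exact: unitQ|].
    move=> y; rewrite indicE; case: (boolP (y \in C)) => [/set_mem[By Yy]|_].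
      rewrite mulr1; have := hF y Yy By T NT g cg ug; rewrite ler_norml; lra.
    by rewrite mulr0; apply: expect_ge0 => v; case: ug => _ /(_ v)/andP[].
  have h3 : gam * (expect (Q T z) g - e) <= (expect (Q T z) g - e) * expect (Q S z) \1_C.
    by rewrite mulrC ler_wpM2l//; case/andP: ce0.
  by move: h1; rewrite ler_norml; lra.
(* The approximation error enters with factor [gam] on the left and factor 1 on the right, hence
   eta/(gam+1). *)
apply/ler_addgt0Pr => eta eta0; have d0 : 0 < eta / (gam + 1) by rewrite divr_gt0// addr_gt0.
have [g [cg ug g1 g2]] := continuous_dense rho_metric borel (Q T z) (Q S z) mA d0.
have uA := unit_fun_indic (R := R) mA.
have := le_trans (expect_dist _ uA ug) g1; have := le_trans (expect_dist _ uA ug) g2.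
have := contg g cg ug; rewrite !ler_norml => c1 /andP[c2 _] /andP[_ c3].
have E : eta = gam * (eta / (gam + 1)) + eta / (gam + 1).
  by rewrite -[X in _ + X]mul1r -mulrDl mulrC divfK// gt_eqF// addr_gt0.
move: E (ler_wpM2l (ltW gam0) c3) c2; move: (eta / (gam + 1)) => dd; lra.
Qed.

(** If it fails, each [A n'] has mass above 2e at some late time, hence so does, up to a smaller set
    [A k], a difference of two of the sets. Domination plants mass gam e/2 of this difference in
    every admissible late [q_S]; repeating it with disjoint differences exceeds total mass 1. *)
Let sigma_smooth (e : R) (A : nat -> set X) : 0 < e -> (forall n, measurable (A n)) ->
  (forall m n, (m <= n)%N -> A n `<=` A m) -> (forall x, exists n, ~ A n x) ->
  exists n, exists2 N : R, 0 < N & forall T, N <= T -> expect (Q T z) \1_(A n) <= 2 * e.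
Proof.
move=> e0 mA decA capA; apply: contrapT => nsmooth.
have [N [gam [P [N0 gam0 recP dom]]]] := domination e0.
have big n : exists2 T, N <= T & 2 * e < expect (Q T z) \1_(A n).
  apply: contrapT => h; apply: nsmooth; exists n; exists N => // T NT.
  by rewrite leNgt; apply/negP => lt; apply: h; exists T.
have mD n k : measurable (A n `\` A k) by exact: measurableD.
have DE (m : probability X R) n k : (n <= k)%N ->
    expect m \1_(A n) = expect m \1_(A n `\` A k) + expect m \1_(A k).
  move=> nk; rewrite -expect_indicU//; last by rewrite setDKI.
  by rewrite setUC setDUK//; exact: decA.
have step M n : exists n' (S0 : R), (n <= n')%N /\ forall S, S0 <= S -> 0 < S -> P S ->
    M%:R * (gam * e / 2) <= expect (Q S z) \1_(A n `\` A n').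
  elim: M n => [|M IH] n.
    exists n, 0; split => // S _ _ _; rewrite mul0r; apply: expect_ge0 => x.
    by rewrite indicE ler0n.
  have [n' [S0 [nn' hS0]]] := IH n; have [T NT lt] := big n'.
  have T0 : 0 < T by exact: lt_le_trans NT.
  (* For the fixed time [T], continuity from above makes the mass of [A k] smaller than the surplus
     of [A n'] over 2e. *)
  have [k [n'k hk]] : exists k, (n' <= k)%N /\ 2 * e <= expect (Q T z) \1_(A n' `\` A k).
    have lim : (fun k => expect (Q T z) \1_(A k)) @ \oo --> (0 : R).
      rewrite -(expect_cst (Q T z) 0); apply: expect_cvg.
      - by move=> k; exact: unit_fun_indic.
      - by apply: unit_fun_cst; rewrite ler01 lexx.
      - move=> x; have [k nAx] := capA x; apply: cvg_near_cst; exists k => // j /= kj.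
        by rewrite indicE memNset// => /(decA _ _ kj).
    have [|K hK] := (cvgn_dist _ _).1 lim (expect (Q T z) \1_(A n') - 2 * e).
      by rewrite subr_gt0.
    exists (maxn K n'); split; first exact: leq_maxr.
    have := hK _ (leq_maxl K n'); rewrite subr0 ler_norml.
    have := DE (Q T z) _ _ (leq_maxr K n'); lra.
  (* Domination gives gam (2e - e) minus [T / S]; for [S] beyond 2T/(gam e) the loss is at most
     half. *)
  exists k, (Num.max S0 (2 * T / (gam * e))); split; first exact: leq_trans n'k.
  move=> S; rewrite ge_max => /andP[S0S TS] S_0 PS.
  have ge0 : 0 < gam * e by rewrite mulr_gt0.
  have TS' : T / S <= gam * e / 2.
    move: TS; rewrite ler_pdivrMr// => h.
    by rewrite ler_pdivrMr// mulrAC ler_pdivlMr//; lra.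
  have h1 := dom S T _ S_0 PS NT (mD n' k).
  have h2 : gam * e <= gam * (expect (Q T z) \1_(A n' `\` A k) - e).
    by rewrite ler_pM2l//; lra.
  have E : A n `\` A k = (A n `\` A n') `|` (A n' `\` A k).
    apply/seteqP; split => x /=.
      by move=> [Anx nAk]; have [?|?] := pselect (A n' x); [right|left].
    move=> [[Anx nAn']|[An'x nAk]]; split => //.
      by move=> /(decA _ _ n'k).
    exact: decA An'x.
  rewrite E expect_indicU//; last first.
    by apply/seteqP; split => // x [[_ ?] []].
  have := hS0 S S0S S_0 PS; rewrite -(natr1 M) mulrDl mul1r; lra.
have c0 : 0 < gam * e / 2 by rewrite divr_gt0// mulr_gt0.
(* Enough disjoint pieces of mass gam e/2 to exceed 1. *)
have [n' [S0 [_ hS0]]] := step (Num.bound (gam * e / 2)^-1).+1 0%N.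
have [S [S0S S_0 PS]] := recP S0; have := hS0 S S0S S_0 PS.
have := expect_le1 (Q S z) (unit_fun_indic (R := R) (mD 0%N n')).
move=> h1 h2; have := le_trans h2 h1; rewrite -ler_pdivlMr// mul1r leNgt => /negP; apply.
apply: lt_trans (archi_boundP _) _; first by rewrite invr_ge0 ltW.
by rewrite ltr_nat.
Qed.

(** Both averages are compared with one [q_S] for [S] much larger than the two times. A final run of
    length [T] hardly changes [q_S], and starts mostly from points of [F e' n], where its outcome is
    close to that from [z]. *)
Let averages_cauchy (e : R) : 0 < e -> exists2 N : R, 0 < N & forall T T' A,
  N <= T -> N <= T' -> measurable A -> `|expect (Q T z) \1_A - expect (Q T' z) \1_A| <= e.
Proof.
(* Each comparison with [q_S] costs 4e', and the two halves of the approximation of [A] add one more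
   e'. *)
move=> e_gt0; pose e' := e / 9; have e0 : 0 < e' by rewrite divr_gt0.
have mF N : measurable (~` F e' N) by exact: (ropen_measurable borel).
have [||n [N N0 hN]] := @sigma_smooth e' (fun N => ~` F e' N) e0 mF.
- move=> m k mk x; apply: contra_not => Fm T kT; apply: Fm.
  by apply: le_trans kT; rewrite ler_nat.
- by move=> x; have [k Fk] := cover_F x e0; exists k => /(_ Fk).
(* The four parts: one for the shift, one for merging on [F e' n], two for the mass of its
   complement. *)
have close T g S : n.+1%:R <= T -> rcontinuous rho g -> unit_fun g -> N <= S ->
    T / e' <= S -> `|expect (Q T z) g - expect (Q S z) g| <= 4 * e'.
  move=> nT cg ug NS TS; have T0 : 0 < T by rewrite (lt_le_trans _ nT).
  have S0 : 0 < S by exact: lt_le_trans NS.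
  have TS' : T / S <= e' by rewrite ler_pdivrMr// mulrC -ler_pdivrMr.
  have h1 := le_trans (Q_shift2 z S0 T0 ug) TS'.
  have c01 : 0 <= expect (Q T z) g <= 1.
    by rewrite expect_le1// expect_ge0// => v; case: ug => _ /(_ v)/andP[].
  have uc := unit_fun_cst (X := X) c01; have uq := unitQ T0 ug.
  have h2 := expect_dist (Q S z) uq uc; rewrite expect_cst in h2.
  have uF := unit_fun_indic (R := R) (mF n).
  have h3 : expect (Q S z) (fun y => `|expect (Q T y) g - expect (Q T z) g|) <=
      e' * expect (Q S z) (fun=> 1) + 1 * expect (Q S z) \1_(~` F e' n).
    have u1 : unit_fun (fun _ : X => 1 : R) by apply: unit_fun_cst; rewrite ler01 lexx.
    rewrite -expect_lin//; apply: le_Rintegral => //.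
    - by apply: unit_fun_integrable; exact: unit_fun_dist.
    - have i1 := integrableZl measurableT e' (unit_fun_integrable (Q S z) u1).
      have i2 := integrableZl measurableT 1 (unit_fun_integrable (Q S z) uF).
      exact: (integrableD measurableT i1 i2).
    - move=> y _; rewrite indicE in_setC mulr1 mul1r; case: (boolP (y \in F e' n)) => /= [/set_mem Fy|_].
        by rewrite addr0; exact: Fy.
      by have [_ /(_ y)/andP[_]] := unit_fun_dist uq uc; lra.
  have := hN S NS; rewrite expect_cst in h3.
  by move: h1 h2; rewrite !ler_norml; lra.
exists (Num.max N n.+1%:R); first by rewrite lt_max N0.
move=> T T' A; rewrite !ge_max => /andP[NT nT] /andP[NT' nT'] mA.
have closeg g : rcontinuous rho g -> unit_fun g ->
    `|expect (Q T z) g - expect (Q T' z) g| <= 8 * e'.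
  move=> cg ug; pose S := Num.max N (Num.max (T / e') (T' / e')).
  have NS : N <= S by rewrite le_max lexx.
  have TS : T / e' <= S by rewrite !le_max lexx orbT.
  have TS' : T' / e' <= S by rewrite !le_max lexx !orbT.
  have := close T g S nT cg ug NS TS; have := close T' g S nT' cg ug NS TS'.
  by rewrite !ler_norml; lra.
have d0 : 0 < e' / 2 by rewrite divr_gt0.
have [g [cg ug g1 g2]] := continuous_dense rho_metric borel (Q T z) (Q T' z) mA d0.
have uA := unit_fun_indic (R := R) mA.
have := le_trans (expect_dist _ uA ug) g1; have := le_trans (expect_dist _ uA ug) g2.
by have := closeg g cg ug; rewrite !ler_norml /e'; lra.
Qed.

(** The limit is built along integer times from [z]; the Cauchy estimate extends it to real times,
    and merging to every starting point. *)
Theorem averages_converge : exists mu : probability X R, forall x (e : R), 0 < e ->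
  exists2 N : R, 0 < N & forall T f, N <= T -> unit_fun f ->
    `|expect (Q T x) f - expect mu f| <= e.
Proof.
have [|mu hmu] := @uniform_cauchy_probability R d X (fun n => Q n.+1%:R z).
  move=> e e0; have [N N0 hN] := averages_cauchy e0.
  have bN k : (Num.bound N <= k)%N -> N <= k.+1%:R.
    move=> Nk; apply/ltW; apply: lt_le_trans (archi_boundP (ltW N0)) _.
    by rewrite ler_nat leqW.
  by exists (Num.bound N) => m n /bN Nm /bN Nn A mA; exact: hN.
exists mu => x e e0; have e30 : 0 < e / 3 by rewrite divr_gt0.
have [N1 N10 h1] := merging x e30; have [N2 N20 h2] := averages_cauchy e30.
have [K hK] := hmu _ e30.
pose k := maxn K (Num.bound N2).
have N2k : N2 <= k.+1%:R.
  apply/ltW; apply: lt_le_trans (archi_boundP (ltW N20)) _.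
  by rewrite ler_nat leqW// leq_maxr.
exists (Num.max N1 N2); first by rewrite lt_max N10.
move=> T f; rewrite ge_max => /andP[N1T N2T] uf.
have sets A : measurable A -> `|expect (Q T z) \1_A - expect mu \1_A| <= 2 * (e / 3).
  move=> mA; have := h2 _ _ _ N2T N2k mA; have := hK k (leq_maxl _ _) A mA.
  by rewrite !ler_norml; lra.
have l1 : expect (Q T z) f <= expect mu f + 2 * (e / 3).
  apply: expect_le_sets => // A mA; rewrite -!expect_indic// -EFinD lee_fin.
  by have := sets A mA; rewrite ler_norml; lra.
have l2 : expect mu f <= expect (Q T z) f + 2 * (e / 3).
  apply: expect_le_sets => // A mA; rewrite -!expect_indic// -EFinD lee_fin.
  by have := sets A mA; rewrite ler_norml; lra.
by have := h1 T N1T f uf; rewrite !ler_norml; lra.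
Qed.
End Ergodic.

(** * Mixtures and uniform laws *)

Section Mixtures.
Context {R : realType} {d1 d2 : measure_display}.
Context {T1 : measurableType d1} {T2 : measurableType d2}.

Lemma mixture (m : probability T1 R) (K : T1 -> probability T2 R) :
  (forall A, measurable A -> measurable_fun setT (fun t => K t A)) ->
  exists n : probability T2 R, forall f : T2 -> \bar R, measurable_fun setT f ->
    (forall x, 0 <= f x)%E -> (\int[n]_x f x = \int[m]_t \int[K t]_x f x)%E.
Proof.
move=> mK; pose K' t : giry T2 R := K t.
have mK' : measurable_fun setT K' by exact: measurable_giry_codensity.
pose n0 : giry T2 R := giry_bind (m : giry T1 R) mK'.
have n0E (f : T2 -> \bar R) : measurable_fun setT f -> (forall x, 0 <= f x)%E ->
    (\int[n0]_x f x = \int[m]_t \int[K t]_x f x)%E.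
  by move=> mf f0; exact: (giry_int_bind (m : giry T1 R) mK' mf f0).
have n0T : n0 setT = 1%E.
  have := n0E (cst 1%E) (measurable_cst _) (fun=> lee01).
  rewrite integral_cst// mul1e => ->.
  rewrite (eq_integral (cst 1%E)); last first.
    by move=> t _; rewrite integral_cst// mul1e; exact: probability_setT.
  by rewrite integral_cst// mul1e; exact: probability_setT.
pose n1 : {measure set T2 -> \bar R} := n0.
pose n2 : probability T2 R :=
  HB.pack (n1 : set T2 -> \bar R) n1 (Measure_isProbability.Build _ _ _ n1 n0T).
by exists n2.
Qed.

Lemma expect_mixture (m : probability T1 R) (K : T1 -> probability T2 R)
    (n : probability T2 R) f :
  (forall A, measurable A -> measurable_fun setT (fun t => K t A)) ->
  (forall f : T2 -> \bar R, measurable_fun setT f ->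
    (forall x, 0 <= f x)%E -> (\int[n]_x f x = \int[m]_t \int[K t]_x f x)%E) ->
  unit_fun f -> expect n f = expect m (fun t => expect (K t) f).
Proof.
move=> mK hn uf; have [mf f01] := uf.
apply: EFin_inj; rewrite -!expectE//; last exact: unit_fun_expect.
rewrite hn; first by under eq_integral do rewrite expectE//.
- exact/measurable_EFinP.
- by move=> x; rewrite lee_fin; case/andP: (f01 x).
Qed.

Lemma unit_fun_fubini1 (m : probability T2 R) (f : T1 * T2 -> R) : unit_fun f ->
  unit_fun (fun x => expect m (fun y => f (x, y))).
Proof.
move=> [mf f01]; have uf x : unit_fun (fun y => f (x, y)).
  by split => //; exact: measurableT_comp mf (measurable_pair1 x).
split; last first.
  by move=> x; rewrite expect_le1// expect_ge0// => y; case/andP: (f01 (x, y)).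
apply: (measurableT_comp (fine_measurable measurableT)).
apply: (@measurable_fun_fubini_tonelli_F _ _ _ _ _ m (fun z => (f z)%:E)).
  exact/measurable_EFinP.
by move=> z; rewrite lee_fin; case/andP: (f01 z).
Qed.

Lemma unit_fun_fubini2 (m : probability T1 R) (f : T1 * T2 -> R) : unit_fun f ->
  unit_fun (fun y => expect m (fun x => f (x, y))).
Proof.
move=> [mf f01]; have uf y : unit_fun (fun x => f (x, y)).
  by split => //; exact: measurableT_comp mf (measurable_pair2 y).
split; last first.
  by move=> y; rewrite expect_le1// expect_ge0// => x; case/andP: (f01 (x, y)).
apply: (measurableT_comp (fine_measurable measurableT)).
apply: (@measurable_fun_fubini_tonelli_G _ _ _ _ _ m (fun z => (f z)%:E)).
  exact/measurable_EFinP.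
by move=> z; rewrite lee_fin; case/andP: (f01 z).
Qed.

Lemma expect_fubini (m1 : probability T1 R) (m2 : probability T2 R) (f : T1 * T2 -> R) :
  unit_fun f -> expect m1 (fun x => expect m2 (fun y => f (x, y))) =
                expect m2 (fun y => expect m1 (fun x => f (x, y))).
Proof.
move=> uf; have [mf f01] := uf; apply: EFin_inj; rewrite -!expectE//; last first.
  exact: unit_fun_fubini1.
  exact: unit_fun_fubini2.
have uf1 x : unit_fun (fun y => f (x, y)).
  by split => //; exact: measurableT_comp mf (measurable_pair1 x).
have uf2 y : unit_fun (fun x => f (x, y)).
  by split => //; exact: measurableT_comp mf (measurable_pair2 y).
under eq_integral do rewrite -expectE//.
under [RHS]eq_integral do rewrite -expectE//.
apply: (fubini_tonelli (fun z => (f z)%:E)); first exact/measurable_EFinP.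
by move=> z; rewrite lee_fin; case/andP: (f01 z).
Qed.
End Mixtures.

(** * Uniform laws on time intervals *)

Section Uniform.
Context {R : realType}.
Local Notation RR := (measurableTypeR R).

Definition is_uniform (T : R) (m : probability RR R) : Prop :=
  forall f : RR -> \bar R, measurable_fun setT f -> (forall s, 0 <= f s)%E ->
  (\int[m]_s f s = T^-1%:E * \int[lebesgue_measure]_(s in `[0%R, T]) f s)%E.

Lemma uniform_exists : exists U : R -> probability RR R,
  forall T : R, 0 < T -> is_uniform T (U T).
Proof.
suff /choice[U hU] : forall T : R, exists m : probability RR R, 0 < T -> is_uniform T m.
  by exists U.
(* For nonpositive [T] the Dirac mass is a placeholder that makes the family total. *)
move=> T; have [T0|T0] := ltP 0 T; last by exists (dirac (0 : RR)).
exists (uniform_prob T0) => _ f mf f0.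
by rewrite integral_uniform// subr0.
Qed.

Lemma lebesgue_measure_shift (u : R) (A : set RR) : measurable A ->
  pushforward lebesgue_measure (fun s : RR => s + u : RR) A = lebesgue_measure A.
Proof.
have mshift : measurable_fun setT (fun s : RR => s + u : RR).
  by apply: measurable_funD.
move=> mA; apply/esym/lebesgue_measure_unique => //= _ [[a b]] _ <-.
rewrite /pushforward (_ : _ @^-1` _ = `]a - u, b - u]%classic).
  rewrite !lebesgue_measure_itv/= !lte_fin ltrD2r; case: ifPn => // _.
  by rewrite -!EFinB; congr (_%:E); lra.
by apply/seteqP; split => s /=; rewrite !in_itv/=; lra.
Qed.

Variables (T : R) (m : probability RR R).
Hypotheses (T0 : 0 < T) (mT : is_uniform T m).

Let itvE f : unit_fun f ->
  (expect m f)%:E = (T^-1%:E * \int[lebesgue_measure]_(s in `[0%R, T]) (f s)%:E)%E.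
Proof.
move=> [mf f01]; rewrite -expectE// mT//; first exact/measurable_EFinP.
by move=> s; rewrite lee_fin; case/andP: (f01 s).
Qed.

Lemma uniform_ext f g : unit_fun f -> unit_fun g ->
  (forall s, 0 <= s <= T -> f s = g s) -> expect m f = expect m g.
Proof.
move=> uf ug fg; apply: EFin_inj; rewrite !itvE//; congr (_ * _)%E.
by apply: eq_integral => s /set_mem; rewrite /= in_itv/= => /fg ->.
Qed.

Lemma uniform_close f (c e : R) : unit_fun f -> 0 <= c <= 1 ->
  (forall s, 0 <= s <= T -> `|f s - c| <= e) -> `|expect m f - c| <= e.
Proof.
move=> uf c01 fc; have [mf f01] := uf.
(* The bound holds on the interval only; clamping the time to [0,T] makes it hold everywhere without
   changing the expectation. *)
pose g s := f (Num.max 0 (Num.min s T) : RR).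
have ug : unit_fun g.
  split; last by move=> s; exact: f01.
  apply: (measurableT_comp mf); apply: measurable_maxr => //.
  exact: measurable_minr.
rewrite (uniform_ext uf ug) => [|s /andP[s0 sT]]; last first.
  by rewrite /g (min_idPl sT) (max_idPr s0).
rewrite -(expect_cst m c); have uc : unit_fun (fun _ : RR => c) := unit_fun_cst c01.
apply: (@expect_close _ _ _ m g (fun=> c) e ug uc) => s.
apply: fc; rewrite le_max lexx ge_max (ltW T0) ge_min lexx orbT.
by [].
Qed.

Let uniform_shift_le f (u : R) : 0 <= u -> unit_fun f ->
  expect m (fun s => f (s + u)) <= expect m f + u / T.
Proof.
move=> u0 uf; have [mf f01] := uf.
have mshift : measurable_fun setT (fun s : RR => s + u : RR) by apply: measurable_funD.
have ufu : unit_fun (fun s : RR => f (s + u)).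
  by split => //; exact: (measurableT_comp mf mshift).
have mfE : measurable_fun setT (fun s => (f s)%:E) by exact/measurable_EFinP.
have f0 s : (0 <= (f s)%:E)%E by rewrite lee_fin; case/andP: (f01 s).
rewrite -lee_fin EFinD !itvE// mulrC EFinM -muleDr//; last first.
  by rewrite ge0_adde_def// inE ?integral_ge0// lee_fin.
apply: lee_wpmul2l; first by rewrite lee_fin invr_ge0 ltW.
have -> : (\int[lebesgue_measure]_(s in `[0%R, T]) (f (s + u))%:E =
    \int[lebesgue_measure]_(s in `[u, (T + u)%R]) (f s)%:E)%E.
  pose sh (s : RR) : RR := s + u.
  have -> : `[0, T]%classic = sh @^-1` `[u, T + u]%classic.
    by apply/seteqP; split => s /=; rewrite /sh !in_itv/=; lra.
  rewrite -(@ge0_integral_pushforward _ _ RR RR R sh mshift lebesgue_measure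
    _ (fun s => (f s)%:E))//; last exact: measurable_funS mfE.
  by apply: eq_measure_integral => A mA _; exact: lebesgue_measure_shift.
apply: (@le_trans _ _ (\int[lebesgue_measure]_(s in `[0%R, T] `|` `]T, (T + u)%R]) (f s)%:E)%E).
  apply: ge0_subset_integral => //; first exact: measurableU.
    exact: measurable_funS mfE.
  move=> s /=; rewrite !in_itv/=; case: (leP s T) => sT; [left|right]; lra.
rewrite ge0_integral_setU//=; [|exact: measurable_funS mfE|]; last first.
  apply/disj_setPS => s [] /=; rewrite !in_itv/=; lra.
rewrite leeD2l//; apply: (@le_trans _ _ (\int[lebesgue_measure]_(s in `]T, (T + u)%R]) 1)%E).
  apply: ge0_le_integral => //; first exact: measurable_funS mfE.
  by move=> s _; rewrite lee_fin; case/andP: (f01 s).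
rewrite integral_cst//= mul1e lebesgue_measure_itv/= lte_fin; case: ifPn => _; rewrite ?lee_fin//.
lra.
Qed.

(** The shifted interval leaves [0,T] only on a piece of length [u], which bounds one side; the
    other side is the same bound applied to [1 - f]. *)
Lemma uniform_shift f (u : R) : 0 <= u -> unit_fun f ->
  `|expect m (fun s => f (s + u)) - expect m f| <= u / T.
Proof.
move=> u0 uf; have h1 := uniform_shift_le u0 uf.
have h2 := uniform_shift_le u0 (unit_fun1B uf).
rewrite !expect1B// in h2; last first.
  have [mf f01] := uf; split => //.
  by apply: (measurableT_comp mf); apply: measurable_funD.
by rewrite ler_norml; lra.
Qed.
End Uniform.

(** * Transition probabilities and time averages of the process *)

Section Transition.
Context {R : realType} {d : measure_display} {X : measurableType d} (rho : X -> X -> R).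
Context {dO : measure_display} {Omega : measurableType dO}.
Variables (Px : X -> probability Omega R) (Phi : R -> Omega -> X).
Hypothesis rho_polish : polish rho.
Hypothesis borel : @measurable d X = <<s ropen rho >>.
Hypothesis markov : cadlag_feller_markov Px Phi rho.
Local Notation RR := (measurableTypeR R).

Let rho_metric : is_metric rho. Proof. by case: rho_polish. Qed.

(** Negative times are sent to 0, so that [P] is a kernel on the whole line and measurability in
    time needs no domain. *)
Definition transition_spec (P : RR -> X -> probability X R) : Prop :=
  forall t x, (forall A, measurable A -> P t x A = Px x (Phi (Num.max 0 t) @^-1` A)) /\
  forall f : X -> \bar R, measurable_fun setT f -> (forall y, 0 <= f y)%E ->
    (\int[P t x]_y f y = \int[Px x]_w f (Phi (Num.max 0%R t) w))%E.

Lemma max0_ge0 (t : R) : 0 <= Num.max 0 t. Proof. by rewrite le_max lexx. Qed.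

Let mPhi (t : R) : 0 <= t -> measurable_fun setT (Phi t).
Proof. by case: markov => h _ _ _ _; exact: h. Qed.

Lemma transition_exists : exists P, transition_spec P.
Proof.
have mP t := mPhi (max0_ge0 t).
pose V t : {mfun Omega >-> X} := mfun_Sub (mem_set (mP t)).
exists (fun t x => distribution (Px x) (V t)) => t x; split => // f mf f0.
by rewrite (ge0_integral_distribution (V t)).
Qed.

Variable P : RR -> X -> probability X R.
Hypothesis P_spec : transition_spec P.

Let PE (t : R) x A : 0 <= t -> measurable A -> P t x A = Px x (Phi t @^-1` A).
Proof. by move=> t0 mA; rewrite (P_spec t x).1// (max_idPr t0). Qed.

Lemma transition_max (t : R) x f : unit_fun f -> expect (P (Num.max 0 t) x) f = expect (P t x) f.
Proof.
move=> [mf f01]; rewrite /expect /Rintegral; congr fine.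
rewrite !(P_spec _ _).2//; [|by [exact/measurable_EFinP|move=> y; rewrite lee_fin; case/andP: (f01 y)]..].
by rewrite (max_idPr (max0_ge0 t)).
Qed.

Let unit_comp (t : R) (f : X -> R) : 0 <= t -> unit_fun f -> unit_fun (fun w => f (Phi t w)).
Proof.
move=> t0 [mf f01]; split => [|w]; last exact: f01.
exact: (measurableT_comp mf (mPhi t0)).
Qed.

Lemma expect_transition (t : R) x f : 0 <= t -> unit_fun f ->
  expect (P t x) f = expect (Px x) (fun w => f (Phi t w)).
Proof.
move=> t0 [mf f01]; rewrite /expect /Rintegral; congr fine.
rewrite (P_spec _ _).2//; first by rewrite (max_idPr t0).
- exact/measurable_EFinP.
- by move=> y; rewrite lee_fin; case/andP: (f01 y).
Qed.

Let P_measurable (t : R) A : measurable A -> measurable_fun setT (fun y => P t y A).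
Proof.
move=> mA; have [_ _ [_ h] _ _] := markov.
rewrite (_ : (fun y => _) = (fun y => Pt Px Phi (Num.max 0 t) y A)).
  by apply: h => //; exact: max0_ge0.
by apply/funext => y; rewrite (P_spec t y).1.
Qed.

Lemma feller_transition (t : R) g : 0 <= t -> rcontinuous rho g -> unit_fun g ->
  rcontinuous rho (fun y => expect (P t y) g).
Proof.
move=> t0 cg ug; have [_ _ _ _ fel] := markov.
rewrite (_ : (fun y => _) = Pf Px Phi t g).
  by apply: fel => //; exists 1 => x; exact: unit_fun_norm.
by apply/funext => y; rewrite expect_transition.
Qed.

Let measurable_step (n : nat) (G : nat -> X -> R) : (forall k, measurable_fun setT (G k)) ->
  measurable_fun setT (fun p : RR * X => G (Num.truncn (Num.max 0 p.1 * n.+1%:R)) p.2).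
Proof.
move=> mG _ B mB; rewrite setTI.
pose I k : set RR := (fun s : RR => Num.max 0 s * n.+1%:R : RR) @^-1` `[k%:R, k.+1%:R[%classic.
have mI k : measurable (I k).
  rewrite -[I k]setTI; have h : measurable_fun setT (fun s : RR => Num.max 0 s * n.+1%:R : RR).
    by apply: measurable_funM => //; exact: measurable_maxr.
  exact: h.
have IE k s : I k s <-> Num.truncn (Num.max 0 s * n.+1%:R) = k.
  have m0 : 0 <= Num.max 0 s * n.+1%:R by rewrite mulr_ge0// max0_ge0.
  rewrite /I/= in_itv/=; split => [/truncn_def//|<-].
  by rewrite truncn_itv.
rewrite (_ : _ @^-1` B = \bigcup_k (I k `*` (G k @^-1` B))); last first.
  apply/seteqP; split => -[s y] /=.
    by move=> By; eexists => //; split; [exact/IE|exact: By].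
  by move=> [k _ [/IE <-]].
apply: bigcupT_measurable => k; apply: measurableX => //.
by rewrite -[X in measurable X]setTI; exact: mG.
Qed.

(** The time is approximated from the right by grid points. Right-continuity of paths, continuity of
    [g] and dominated convergence make the expectation a limit of functions that are piecewise
    constant in time. *)
Let measurable_cont g : rcontinuous rho g -> unit_fun g ->
  measurable_fun setT (fun p : RR * X => expect (P p.1 p.2) g).
Proof.
move=> cg ug; have [_ cad _ _ _] := markov.
(* The successor puts the grid point strictly to the right of [s], within 1/(n+1) of it. *)
pose t (n : nat) (s : R) : R := (Num.truncn (Num.max 0 s * n.+1%:R)).+1%:R / n.+1%:R.
have t0 n s : 0 <= t n s by rewrite divr_ge0.
apply: (@measurable_fun_cvg _ _ _ setT (fun n (p : RR * X) => expect (P (t n p.1) p.2) g)).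
  move=> n; apply: (measurable_step n (G := fun k y => expect (P (k.+1%:R / n.+1%:R) y) g)) => k.
  by case: (unit_fun_expect (fun A mA => @P_measurable (k.+1%:R / n.+1%:R) A mA) ug).
move=> [s y] _ /=; rewrite -transition_max// expect_transition ?max0_ge0//.
rewrite (_ : (fun n => _) = (fun n => expect (Px y) (fun w => g (Phi (t n s) w)))); last first.
  by apply/funext => n; rewrite expect_transition.
apply: expect_cvg; [by move=> n; exact: unit_comp|exact: (unit_comp (max0_ge0 s))|].
move=> w; apply/cvgn_dist => e e0.
have [r [r0 hr]] := cg (Phi (Num.max 0 s) w) e e0.
have [c1 _] := cad w; have [del [del0 hdel]] := c1 _ (max0_ge0 s) r r0.
have [N _ hN] := near_infty_natSinv_lt (PosNum del0).
exists N => n /hN /= nd; apply/ltW/hr/hdel.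
- rewrite /t ler_pdivlMr ?ltr0n//; apply/ltW.
  exact: truncnS_gt.
- rewrite /t ltr_pdivrMr ?ltr0n// mulrDl -natr1.
  have h1 : (Num.truncn (Num.max 0 s * n.+1%:R))%:R <= Num.max 0 s * n.+1%:R.
    by rewrite truncn_le// mulr_ge0// max0_ge0.
  have h2 : 1 < del * n.+1%:R by rewrite -ltr_pdivrMr ?ltr0n// mul1r.
  by apply: ler_ltD.
Qed.

Lemma measurable_transition A : measurable A ->
  measurable_fun setT (fun p : RR * X => P p.1 p.2 A).
Proof.
suff h : measurable A -> measurable_fun setT (fun p : RR * X => expect (P p.1 p.2) \1_A).
  move=> mA; rewrite (_ : (fun p => _) = (fun p : RR * X => (expect (P p.1 p.2) \1_A)%:E)).
    by apply/measurable_EFinP; exact: h.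
  by apply/funext => p; rewrite expect_indic.
rewrite {1}borel; move: A; apply: (@dynkin_induction _ _ (ropen rho)) => //.
- exact: ropenI.
- rewrite (_ : (fun p => _) = cst 1)//; apply/funext => p /=.
  by rewrite -(expect_cst (P p.1 p.2) 1); congr expect; apply/funext => x; rewrite indicT.
- move=> U oU; have [g [cg ug _ gU]] := ropen_approx_unit rho_metric borel oU.
  apply: (@measurable_fun_cvg _ _ _ setT (fun n (p : RR * X) => expect (P p.1 p.2) (g n))).
    by move=> n; exact: measurable_cont.
  move=> p _; apply: expect_cvg => //; apply: unit_fun_indic.
  exact: (ropen_measurable borel).
- move=> A mA hA.
  rewrite (_ : (fun p => _) = (fun p : RR * X => 1 - expect (P p.1 p.2) \1_A)).
    exact: measurable_funB.
  by apply/funext => p; rewrite expect_indicC.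
- move=> F mF tF hF.
  apply: (@measurable_fun_cvg _ _ _ setT
    (fun n (p : RR * X) => expect (P p.1 p.2) \1_(\big[setU/set0]_(i < n) F i))).
    elim=> [|n IH].
      rewrite (_ : (fun p => _) = cst 0)//; apply/funext => p /=.
      rewrite -(expect_cst (P p.1 p.2) 0); congr expect; apply/funext => x.
      by rewrite big_ord0 indic0.
    rewrite (_ : (fun p => _) = (fun p : RR * X =>
      expect (P p.1 p.2) \1_(\big[setU/set0]_(i < n) F i) + expect (P p.1 p.2) \1_(F n))).
      exact: measurable_funD.
    apply/funext => p; rewrite big_ord_recr/= expect_indicU//.
      exact: bigsetU_measurable.
    rewrite -bigcup_mkord; apply/seteqP; split => // x [[k /= kn Fkx] Fnx].
    move/trivIsetP: tF => /(_ k n I I (negbT (ltn_eqF kn))) h.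
    by have : (F k `&` F n) x by []; rewrite h.
  by move=> p _; exact: (expect_indic_bigcup (m := P p.1 p.2)).
Qed.

Lemma chapman_kolmogorov (s t : R) x f : 0 <= s -> 0 <= t -> unit_fun f ->
  expect (P (s + t) x) f = expect (P s x) (fun y => expect (P t y) f).
Proof.
move=> s0 t0 uf; have [mf f01] := uf; have [_ _ _ mk _] := markov.
have [n hn] := mixture (P s x) (fun A mA => @P_measurable t A mA).
rewrite -(expect_mixture (n := n) _ hn)//; last exact: P_measurable.
rewrite /expect /Rintegral; congr fine; apply: eq_measure_integral => A mA _.
have := hn (fun y => (\1_A y)%:E); rewrite integral_indic// setIT => ->; last 2 first.
- exact/measurable_EFinP/measurable_indic.
- by move=> y; rewrite lee_fin indicE ler0n.
under eq_integral do rewrite integral_indic// setIT.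
rewrite (P_spec s x).2//; last exact: P_measurable.
rewrite [LHS]PE ?addr_ge0//.
(* The Markov property is used with the sure event, which lies in the filtration at time [s]. *)
have := mk x s t setT A s0 t0 _ mA; rewrite setTI => ->; last first.
  by apply: sub_sigma_algebra; exists 0, setT; rewrite lexx s0 preimage_setT.
by apply: eq_integral => w _; rewrite (max_idPr s0) [RHS]PE.
Qed.

Lemma measurable_transition_time x A : measurable A -> measurable_fun setT (fun s : RR => P s x A).
Proof.
by move=> mA; exact: (measurableT_comp (measurable_transition mA) (measurable_pair2 x)).
Qed.

Lemma unit_transition f : unit_fun f -> unit_fun (fun p : RR * X => expect (P p.1 p.2) f).
Proof. by apply: unit_fun_expect => A mA; exact: measurable_transition. Qed.

Let unit_transition_time x f : unit_fun f -> unit_fun (fun s : RR => expect (P s x) f).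
Proof. by apply: unit_fun_expect => A mA; exact: measurable_transition_time. Qed.

Lemma unit_transition_space (t : R) f : unit_fun f -> unit_fun (fun y => expect (P t y) f).
Proof. by apply: unit_fun_expect => A mA; exact: P_measurable. Qed.

(** * Time averages as mixtures of transition probabilities *)

Variable U : R -> probability RR R.
Hypothesis U_unif : forall T : R, 0 < T -> is_uniform T (U T).

Definition average_spec (Q : R -> X -> probability X R) : Prop :=
  forall (T : R) x (f : X -> \bar R), measurable_fun setT f -> (forall y, 0 <= f y)%E ->
  (\int[Q T x]_y f y = \int[U T]_s \int[P s x]_y f y)%E.

Lemma average_exists : exists Q, average_spec Q.
Proof.
suff /choice[Q hQ] : forall p : R * X, exists m : probability X R, forall f : X -> \bar R,
    measurable_fun setT f -> (forall y, 0 <= f y)%E ->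
    (\int[m]_y f y = \int[U p.1]_s \int[P s p.2]_y f y)%E.
  by exists (fun T x => Q (T, x)) => T x f mf f0; rewrite hQ.
by move=> [T x]; apply: mixture => A mA; exact: measurable_transition_time.
Qed.

Variable Q : R -> X -> probability X R.
Hypothesis Q_spec : average_spec Q.

Lemma expect_average (T : R) x f : unit_fun f ->
  expect (Q T x) f = expect (U T) (fun s => expect (P s x) f).
Proof.
move=> uf; apply: (expect_mixture _ (@Q_spec T x) uf) => A mA.
exact: measurable_transition_time.
Qed.

Lemma measurable_average (T : R) A : measurable A -> measurable_fun setT (fun y => Q T y A).
Proof.
move=> mA; have uA := unit_fun_indic (R := R) mA.
rewrite (_ : (fun y => _) = (fun y => (expect (U T) (fun s => expect (P s y) \1_A))%:E)).
  apply/measurable_EFinP.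
  by case: (unit_fun_fubini2 (U T) (unit_transition uA)).
by apply/funext => y; rewrite -expect_average// expect_indic.
Qed.

Lemma unit_average (T : R) f : unit_fun f -> unit_fun (fun y => expect (Q T y) f).
Proof. by apply: unit_fun_expect => A mA; exact: measurable_average. Qed.

Let transition_twice (u s : R) x f : unit_fun f ->
  expect (P u x) (fun y => expect (P s y) f) = expect (P (Num.max 0 u + Num.max 0 s) x) f.
Proof.
move=> uf; rewrite chapman_kolmogorov ?max0_ge0// transition_max; last first.
  exact: unit_transition_space.
by congr expect; apply/funext => y; rewrite transition_max.
Qed.

Let unit_sum x f : unit_fun f ->
  unit_fun (fun p : RR * RR => expect (P (Num.max 0 p.1 + Num.max 0 p.2) x) f).
Proof.
move=> uf; have [mf f01] := unit_transition_time x uf; split; last first.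
  by move=> p; exact: f01.
have msum : measurable_fun setT (fun p : RR * RR => Num.max 0 p.1 + Num.max 0 p.2 : RR).
  by apply: measurable_funD; apply: measurable_maxr.
exact: (measurableT_comp mf msum).
Qed.

Let average_shift (S u : R) x f : 0 < S -> 0 <= u -> unit_fun f ->
  `|expect (U S) (fun s => expect (P (Num.max 0 u + Num.max 0 s) x) f) -
    expect (Q S x) f| <= u / S.
Proof.
move=> S0 u0 uf; have ut := unit_transition_time x uf; rewrite expect_average//.
have mshift : measurable_fun setT (fun s : RR => s + u : RR) by apply: measurable_funD.
have uf1 : unit_fun (fun s : RR => expect (P (s + u) x) f).
  by case: ut => mf f01; split => //; exact: (measurableT_comp mf mshift).
have uf2 : unit_fun (fun s : RR => expect (P (Num.max 0 u + Num.max 0 s) x) f).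
  have [mf f01] := unit_sum x uf; split; last by move=> s; exact: (f01 (u, s)).
  exact: (measurableT_comp mf (measurable_pair1 (u : RR))).
rewrite (uniform_ext (U_unif S0) uf2 uf1); last first.
  by move=> s /andP[s0 _]; rewrite (max_idPr u0) (max_idPr s0) addrC.
exact: (uniform_shift S0 (U_unif S0) u0 ut).
Qed.

Let transition_average (u S : R) x f : unit_fun f ->
  expect (P u x) (fun y => expect (Q S y) f) =
  expect (U S) (fun s => expect (P (Num.max 0 u + Num.max 0 s) x) f).
Proof.
move=> uf; rewrite (_ : (fun y => expect (Q S y) f) =
    (fun y => expect (U S) (fun s => expect (P s y) f))); last first.
  by apply/funext => y; exact: expect_average.
rewrite -(expect_fubini (U S) (P u x) (unit_transition uf)) /=.
by congr expect; apply/funext => s; rewrite transition_twice.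
Qed.

Lemma average_shift1 (S T : R) x f : 0 < S -> 0 < T -> unit_fun f ->
  `|expect (Q T x) (fun y => expect (Q S y) f) - expect (Q S x) f| <= T / S.
Proof.
move=> S0 T0 uf; rewrite expect_average; last exact: unit_average.
apply: (uniform_close T0 (U_unif T0)).
- exact/unit_transition_time/unit_average.
- by case: (unit_average S uf) => _; exact.
- move=> u /andP[u0 uT]; rewrite transition_average//.
  apply: (le_trans (average_shift x S0 u0 uf)).
  by rewrite ler_pM2r// invr_gt0.
Qed.

(** Fubini exchanges the two random times, so that the short one is fixed first and acts as a
    deterministic delay of at most [T]. *)
Lemma average_shift2 (S T : R) x f : 0 < S -> 0 < T -> unit_fun f ->
  `|expect (Q S x) (fun y => expect (Q T y) f) - expect (Q S x) f| <= T / S.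
Proof.
move=> S0 T0 uf; rewrite expect_average; last exact: unit_average.
rewrite (_ : (fun u => expect (P u x) _) = (fun u => expect (U T) (fun s =>
    expect (P (Num.max 0 u + Num.max 0 s) x) f))); last first.
  by apply/funext => u; rewrite transition_average.
rewrite (expect_fubini (U S) (U T) (unit_sum x uf)).
apply: (uniform_close T0 (U_unif T0)).
- exact: (unit_fun_fubini2 (U S) (unit_sum x uf)).
- by case: (unit_average S uf) => _; exact.
- move=> s /andP[s0 sT] /=.
  rewrite (_ : (fun u => _) = (fun u => expect (P (Num.max 0 s + Num.max 0 u) x) f)); last first.
    by apply/funext => u; rewrite addrC.
  apply: (le_trans (average_shift x S0 s0 uf)).
  by rewrite ler_pM2r// invr_gt0.
Qed.

Lemma average_transition_shift (T t : R) x f : 0 < T -> 0 <= t -> unit_fun f ->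
  `|expect (Q T x) (fun y => expect (P t y) f) - expect (Q T x) f| <= t / T.
Proof.
move=> T0 t0 uf; rewrite expect_average; last exact: unit_transition_space.
rewrite (_ : (fun s => _) = (fun s => expect (P (Num.max 0 t + Num.max 0 s) x) f)).
  exact: average_shift.
by apply/funext => s; rewrite transition_twice// addrC.
Qed.

(** The Feller modulus of continuity depends on the time [s], so continuity is checked along a
    sequence, where dominated convergence over [s] applies. *)
Lemma feller_average (T : R) g : 0 < T -> rcontinuous rho g -> unit_fun g ->
  rcontinuous rho (fun y => expect (Q T y) g).
Proof.
move=> T0 cg ug y e; move: (e : R) => {}e e0; apply: contrapT => disc.
have bad (n : nat) : exists v, rho y v < n.+1%:R^-1 /\
    e <= `|expect (Q T v) g - expect (Q T y) g|.
  apply: contrapT => h; apply: disc; exists n.+1%:R^-1; split; first by rewrite invr_gt0 ltr0n.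
  by move=> v yv; rewrite ltNge; apply/negP => le; apply: h; exists v.
have [v hv] := choice bad.
have lim : (fun n => expect (Q T (v n)) g) @ \oo --> expect (Q T y) g.
  rewrite expect_average// (_ : (fun n => _) = (fun n => expect (U T)
      (fun s => expect (P s (v n)) g))); last first.
    by apply/funext => n; rewrite expect_average.
  apply: expect_cvg; [by move=> n; exact: unit_transition_time|exact: unit_transition_time|].
  move=> s; apply/cvgn_dist => r r0.
  have [del [del0 hdel]] := feller_transition (max0_ge0 s) cg ug y r0.
  have [N _ hN] := near_infty_natSinv_lt (PosNum del0).
  exists N => n Nn; have := hdel (v n) (lt_trans (hv n).1 (hN n Nn)).
  by rewrite !transition_max// => /ltW.
have e20 : 0 < e / 2 by rewrite divr_gt0.
have [N hN] := (cvgn_dist _ _).1 lim _ e20.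
have := le_trans (hv N).2 (hN N (leqnn _)); lra.
Qed.
End Transition.

(** * Maximal coupling *)

Section Coupling.
Context {R : realType} {d : measure_display} {X : measurableType d} (rho : X -> X -> R).
Hypothesis rho_polish : polish rho.
Hypothesis borel : @measurable d X = <<s ropen rho >>.

Let rho_metric : is_metric rho. Proof. by case: rho_polish. Qed.

(** By separability, two distinct points are separated by one of countably many balls, so the
    off-diagonal is a countable union of rectangles. *)
Lemma measurable_offdiag : measurable [set p : X * X | p.1 <> p.2].
Proof.
have [_ _ [D denseD]] := rho_polish; have [rho0 rhoE rhoC rhoD] := rho_metric.
pose B n (k : nat) := rball rho (D n) k.+1%:R^-1.
have mB n k : measurable (B n k).
  by apply: (ropen_measurable borel); exact: ropen_rball.
rewrite (_ : [set _ | _] = \bigcup_n \bigcup_k (B n k `*` ~` B n k)).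
  by do 2 apply: bigcupT_measurable => ?; apply: measurableX => //; exact: measurableC.
apply/seteqP; split => -[x y] /=; last first.
  by move=> [n _ [k _ [Bx nBy]]] xy; apply: nBy; rewrite -xy.
move=> xy; have r0 : 0 < rho x y.
  by rewrite lt_neqAle rho0 andbT eq_sym; apply/eqP => /rhoE.
have [k _ hk] := near_infty_natSinv_lt (PosNum (divr_gt0 r0 (ltr0n R 2))).
have {}hk : k.+1%:R^-1 < rho x y / 2 :> R by exact: (hk k (leqnn _)).
have [|n hn] := denseD x (k.+1%:R^-1 : R); first by rewrite invr_gt0 ltr0n.
exists n => //; exists k => //; split; first by rewrite /B /rball/= rhoC.
rewrite /B /rball/= => Dy; have := rhoD x (D n) y; apply/negP; rewrite -ltNge (splitr (rho x y)).
by apply: ltrD; apply: lt_trans hk.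
Qed.

(** The common part is put on the diagonal, and the excesses are coupled independently, normalised
    by their mass c. Only the product charges the off-diagonal; its integral splits into those of
    [W] against the two excesses, each at most K c plus the integral of [h] against the original
    measure. *)
Lemma maximal_coupling (m1 m2 : probability X R) (W : X -> R) :
  measurable_fun setT W -> (forall x, 0 <= W x) ->
  exists (P : set X) (pi : probability (X * X)%type R), [/\ measurable P,
    forall A, measurable A -> pi (A `*` setT) = m1 A /\ pi (setT `*` A) = m2 A &
    forall (K : R) (h : X -> R), 0 <= K -> measurable_fun setT h -> (forall x, 0 <= h x) ->
      (forall x, W x <= K + h x) ->
      (\int[pi]_(p in [set p : X * X | p.1 <> p.2]) (W p.1 + W p.2)%:E <=
       (2 * K)%:E * (m1 P - m2 P) + \int[m1]_x (h x)%:E + \int[m2]_x (h x)%:E)%E].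
Proof.
move=> mW W0; have [P [m [n1 [n2 [mP E1 E2 n1T n2T]]]]] := hahn_split m1 m2.
pose c := fine (n1 setT).
have c0 : 0 <= c by rewrite fine_ge0.
have cE : c%:E = n1 setT by rewrite /c fineK// fin_num_measure.
have cE2 : c%:E = n2 setT by rewrite cE n2T n1T.
pose diag (x : X) : X * X := (x, x).
have mdiag : measurable_fun setT diag by exact: measurable_fun_pair.
have ci0 : 0 <= c^-1 by rewrite invr_ge0.
pose k := NngNum ci0.
pose push : {measure set (X * X) -> \bar R} := pushforward m diag.
pose pi1 : {measure set (X * X) -> \bar R} := push mdiag.
pose pi2 : {measure set (X * X) -> \bar R} := mscale k (n1 \x n2)%E.
pose pi0 : {measure set (X * X) -> \bar R} := measure_add pi1 pi2.
have pi0E A : pi0 A = (m (diag @^-1` A) + c^-1%:E * (n1 \x n2) A)%E.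
  exact: measure_addE.
have prodE A B : measurable A -> measurable B -> ((n1 \x n2) (A `*` B) = n1 A * n2 B)%E.
  exact: product_measure1E.
have le_n (n : {finite_measure set X -> \bar R}) A : n setT = c%:E -> measurable A ->
    (c^-1%:E * (n A * c%:E) = n A)%E.
  (* For c = 0 the excesses vanish and the inverse is 0 by convention, so the marginals remain
     correct. *)
  move=> nT mA; have [cz|cn] := eqVneq c 0.
    have : (n A <= 0)%E by rewrite -[0%E]/(0%:E) -cz -nT le_measure// inE.
    by rewrite measure_le0 => /eqP ->; rewrite mul0e mule0.
  by rewrite muleC -muleA -EFinM divff// mule1.
have marg A : measurable A -> pi0 (A `*` setT) = m1 A /\ pi0 (setT `*` A) = m2 A.
  move=> mA; rewrite !pi0E !prodE// -cE -cE2 E1// E2//; split.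
    rewrite le_n//; congr (_ + _)%E; congr (m _).
    by apply/seteqP; split => x //= [].
  rewrite [X in (_ * X)%E]muleC le_n//; congr (_ + _)%E; congr (m _).
  by apply/seteqP; split => x //= [].
have pi0T : pi0 setT = 1%E.
  by have [+ _] := marg _ measurableT; rewrite setXTT probability_setT.
pose pi : probability (X * X)%type R :=
  HB.pack (pi0 : set (X * X) -> \bar R) pi0 (Measure_isProbability.Build _ _ _ pi0 pi0T).
exists P, pi; split => // K h K0 mh h0 WKh.
set D := [set p : X * X | p.1 <> p.2]; have mD : measurable D := measurable_offdiag.
have mWE : measurable_fun setT (fun x => (W x)%:E) by exact/measurable_EFinP.
have mhE : measurable_fun setT (fun x => (h x)%:E) by exact/measurable_EFinP.
have mF : measurable_fun setT (fun p : X * X => (W p.1 + W p.2)%:E).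
  apply/measurable_EFinP; apply: measurable_funD.
    exact: (measurableT_comp mW measurable_fst).
  exact: (measurableT_comp mW measurable_snd).
have F0 (p : X * X) : (0 <= (W p.1 + W p.2)%:E)%E by rewrite lee_fin addr_ge0.
have -> : (\int[pi]_(p in D) (W p.1 + W p.2)%:E =
    \int[measure_add pi1 pi2]_(p in D) (W p.1 + W p.2)%:E)%E.
  by apply: eq_measure_integral.
rewrite ge0_integral_measure_add//; last exact: measurable_funS mF.
have -> : (\int[pi1]_(p in D) (W p.1 + W p.2)%:E = 0)%E.
  rewrite (@ge0_integral_pushforward _ _ _ _ _ diag mdiag m D (fun p => (W p.1 + W p.2)%:E))//.
    rewrite (_ : diag @^-1` D = set0) ?integral_set0//.
    by apply/seteqP; split => x.
  exact: measurable_funS mF.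
rewrite add0e ge0_integral_mscale//; last exact: measurable_funS mF.
have tail (n : {finite_measure set X -> \bar R}) (m' : probability X R) : n setT = c%:E ->
    (forall A, measurable A -> m' A = (m A + n A)%E) ->
    (\int[n]_x (W x)%:E <= (K * c)%:E + \int[m']_x (h x)%:E)%E.
  move=> nT m'E.
  rewrite (@eq_measure_integral _ _ _ _ (measure_add m n) m'); last first.
    by move=> A mA _; rewrite -[RHS]/(measure_add m n A) [RHS]measure_addE -m'E.
  rewrite ge0_integral_measure_add//; last by move=> x _; rewrite lee_fin.
  apply: (@le_trans _ _ (\int[n]_x (K%:E + (h x)%:E))%E).
    apply: ge0_le_integral => //.
    - by move=> x _; rewrite lee_fin.
    - exact: emeasurable_funD.
    - by move=> x _; rewrite -EFinD lee_fin.
  rewrite ge0_integralD//; last by move=> x _; rewrite lee_fin.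
  have -> : (\int[n]_x K%:E = (K * c)%:E)%E by rewrite integral_cst// EFinM -nT.
  apply: leeD => //.
  by rewrite leeDr// integral_ge0// => x _; rewrite lee_fin.
have t1 := tail n1 m1 (esym cE) E1; have t2 := tail n2 m2 (esym cE2) E2.
have J0 (n : {finite_measure set X -> \bar R}) : (0 <= \int[n]_x (W x)%:E)%E.
  by apply: integral_ge0 => x _; rewrite lee_fin.
apply: (@le_trans _ _ (\int[n1]_x (W x)%:E + \int[n2]_x (W x)%:E)%E); last first.
  rewrite -n1T -cE -EFinM.
  have -> : (2 * K * c)%:E = ((K * c)%:E + (K * c)%:E)%E by rewrite -EFinD; congr (_%:E); lra.
  apply: (le_trans (leeD t1 t2)).
  by rewrite addeACA -[leRHS]addeA.
apply: (@le_trans _ _ (k%:num%:E * \int[(n1 \x n2)%E]_p (W p.1 + W p.2)%:E)%E).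
  by apply: lee_wpmul2l => //; apply: ge0_subset_integral.
rewrite (fubini_tonelli1 (fun p : X * X => (W p.1 + W p.2)%:E))// /fubini_F /=.
rewrite (eq_integral (fun x => (W x)%:E * c%:E + \int[n2]_y (W y)%:E)%E); last first.
  move=> x _; under eq_integral do rewrite EFinD.
  rewrite ge0_integralD//; [|by move=> *; rewrite lee_fin..].
  by rewrite integral_cst// cE2.
rewrite ge0_integralD//; last 2 first.
- by move=> x _; rewrite mule_ge0// lee_fin.
- by apply: emeasurable_funM.
rewrite ge0_integralZr//; [|by move=> *; rewrite lee_fin..].
have -> : (\int[n1]_x \int[n2]_y (W y)%:E = \int[n2]_y (W y)%:E * c%:E)%E.
  by rewrite integral_cst// cE.
rewrite -ge0_muleDl; [|exact: J0|exact: J0].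
rewrite muleC -muleA.
have [cz|cn] := eqVneq c 0; first by rewrite cz mul0e mule0 adde_ge0.

by rewrite -EFinM divff// mule1.
Qed.
End Coupling.

(** * Weighted averages *)

Lemma ge0_integrable_lty (R : realType) d (X : measurableType d) (m : {measure set X -> \bar R})
    (D : set X) (h : X -> R) : measurable D -> measurable_fun D h -> (forall x, D x -> 0 <= h x) ->
  (\int[m]_(x in D) (h x)%:E < +oo)%E -> m.-integrable D (EFin \o h).
Proof.
move=> mD mh h0 hoo; apply/integrableP; split; first exact/measurable_EFinP.
rewrite (eq_integral (fun x => (h x)%:E))// => x /set_mem Dx /=.
by rewrite ger0_norm// h0.
Qed.

Lemma integral_cst_probability (R : realType) d (X : measurableType d) (m : probability X R)
    (c : R) : (\int[m]_x c%:E = c%:E)%E.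
Proof. by rewrite integral_cst//= probability_setT mule1. Qed.

Section LimsupInfty.
Context {R : realType}.
Implicit Types (g : R -> \bar R) (c : R).

Lemma limsup_infty_eq0 g : (forall t, 0 <= g t)%E ->
  (forall e : R, 0 < e -> exists T0, forall t, T0 <= t -> (g t <= e%:E)%E) ->
  limsup_infty g = 0%E.
Proof.
move=> g0 gle; apply/eqP; rewrite eq_le; apply/andP; split.
  apply/lee_addgt0Pr => e e0; rewrite add0e; have [T0 hT0] := gle e e0.
  apply: ge_ereal_inf; exists (ereal_sup (g @` [set t | T0 <= t])); first by exists T0.
  by apply: ge_ereal_sup => _ [t /= Tt <-]; exact: hT0.
apply: le_ereal_inf_tmp => _ [T _ <-].
by apply: le_ereal_sup_tmp; exists (g T) => //; exists T => //=.
Qed.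

Lemma limsup_infty_ge g c : (forall T0, exists2 t, T0 <= t & (c%:E <= g t)%E) ->
  (c%:E <= limsup_infty g)%E.
Proof.
move=> h; apply: le_ereal_inf_tmp => _ [T _ <-]; have [t Tt ct] := h T.
by apply: le_ereal_sup_tmp; exists (g t) => //; exists t.
Qed.

Lemma limsup_infty_gt g c T0 : (c%:E < limsup_infty g)%E ->
  exists2 t, T0 <= t & (c%:E < g t)%E.
Proof.
move=> h; have : (c%:E < ereal_sup (g @` [set t | (T0 <= t)%R]))%E.
  by apply: lt_le_trans h _; apply: ereal_inf_lbound; exists T0.
by move=> /ereal_sup_gt[_ [t Tt <-] ct]; exists t.
Qed.

Lemma limsup_infty_lt g c : (limsup_infty g < c%:E)%E ->
  exists T0, forall t, T0 <= t -> (g t < c%:E)%E.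
Proof.
move=> /ereal_inf_lt[_ [T0 _ <-] lt]; exists T0 => t Tt.
by apply: le_lt_trans lt; apply: ereal_sup_ubound; exists t.
Qed.
End LimsupInfty.

Section Tail.
Context {R : realType} {d : measure_display} {X : measurableType d}.
Implicit Types (W : X -> R) (K : R).

(** The part of [W] measured by uniform integrability; through [le_tail] it plays the role of [h] in
    the coupling bound. *)
Definition tail W K (y : X) : R := if K <= W y then W y else 0.

Lemma measurable_tail W K : measurable_fun setT W -> measurable_fun setT (tail W K).
Proof.
move=> mW; apply: measurable_fun_if => //; last exact: measurable_funS mW.
exact: measurable_fun_ler.
Qed.

Lemma tail_ge0 W K y : 0 <= W y -> 0 <= tail W K y.
Proof. by rewrite /tail; case: ifP. Qed.

Lemma le_tail W K y : 0 <= K -> W y <= K + tail W K y.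
Proof. by move=> K0; rewrite /tail; case: (leP K (W y)) => h; lra. Qed.
End Tail.

Section WeightedAverages.
Context {R : realType} {d : measure_display} {X : measurableType d} (rho : X -> X -> R).
Context {dO : measure_display} {Omega : measurableType dO}.
Variables (Px : X -> probability Omega R) (Phi : R -> Omega -> X) (V : X -> R).
Hypothesis rho_polish : polish rho.
Hypothesis borel : @measurable d X = <<s ropen rho >>.
Hypothesis markov : cadlag_feller_markov Px Phi rho.
Hypothesis V_ge0 : forall x, 0 <= V x.
Hypothesis V_cont : rcontinuous rho V.
Hypothesis V_H2 : H2 Px Phi (FF_V V).
Local Notation RR := (measurableTypeR R).

Variables (P : RR -> X -> probability X R) (U : R -> probability RR R)
  (Q : R -> X -> probability X R).
Hypothesis P_spec : transition_spec Px Phi P.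
Hypothesis U_unif : forall T : R, 0 < T -> is_uniform T (U T).
Hypothesis Q_spec : average_spec P U Q.

Let rho_metric : is_metric rho. Proof. by case: rho_polish. Qed.

Let mV : measurable_fun setT V.
Proof. exact: (rcontinuous_measurable borel). Qed.

Let FF_weight : FF_V V (fun y => 1 + V y).
Proof.
split; first exact: measurable_funD.
by move=> x; rewrite ger0_norm// addr_ge0.
Qed.

Let FF_unit f : unit_fun f -> FF_V V f.
Proof.
move=> uf; split; first by case: uf.
by move=> x; apply: le_trans (unit_fun_norm x uf) _; rewrite lerDl.
Qed.

Let measurable_int (f : X -> \bar R) x : measurable_fun setT f -> (forall y, 0 <= f y)%E ->
  measurable_fun setT (fun s : RR => \int[P s x]_y f y)%E.
Proof.
move=> mf f0; apply: (@measurable_fun_integral_kernel _ _ RR X R (fun s => P s x)) => //.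
by move=> A mA; exact: (measurable_transition_time rho_polish borel markov P_spec).
Qed.

(** [1 + V] itself belongs to the class, so the dominating function of H2 is at least [1 + V]. Its
    tail bound is uniform in time, hence survives averaging over time. *)
Lemma dominating_weight : exists W : X -> R, [/\ measurable_fun setT W,
  forall y, 1 + V y <= W y & forall x (e : R), 0 < e -> exists K : R, [/\ 0 < K,
    forall T, (\int[Q T x]_y (tail W K y)%:E <= e%:E)%E &
    forall t, (\int[P t x]_y (tail W K y)%:E <= e%:E)%E]].
Proof.
have [W [[mW _] WFF uiW]] := V_H2.
have WV y : 1 + V y <= W y.
  by have := WFF _ FF_weight y; rewrite ger0_norm// addr_ge0.
have W0 y : 0 <= W y by apply: le_trans (WV y); rewrite addr_ge0.
exists W; split => // x e e0.
have ene : (0 < e%:E)%E by rewrite lte_fin.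
have [M [_ hM]] := uiW x _ (open_ereal_lt' ene).
pose K := Num.max M 0 + 1.
have MK : M < K by rewrite /K ltr_pwDr// le_max lexx.
have K0 : 0 < K by rewrite /K ltr_wpDl// le_max lexx orbT.
have mtail : measurable_fun setT (fun y => (tail W K y)%:E).
  by apply/measurable_EFinP; exact: measurable_tail.
have tail0 y : (0 <= (tail W K y)%:E)%E by rewrite lee_fin; exact: tail_ge0.
have tailP t : (\int[P t x]_y (tail W K y)%:E <= e%:E)%E.
  rewrite (P_spec t x).2//; apply/ltW; apply: le_lt_trans (hM _ MK).
  apply: ereal_sup_ubound; exists (Num.max 0 t); first exact: max0_ge0.
  rewrite integral_mkcond; apply: eq_integral => w _; rewrite patchE /tail.
  case: ifPn; [rewrite inE/=|rewrite notin_setE/=]; rewrite (ger0_norm (W0 _)).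
    by move=> ->.
  by move=> /negP/negbTE ->.
exists K; split => // T; rewrite Q_spec//.
apply: (@le_trans _ _ (\int[U T]_s e%:E)%E); last first.
  by rewrite integral_cst_probability.
apply: ge0_le_integral => //.
- by move=> s _; apply: integral_ge0.
- exact: measurable_int.
Qed.

Let tail_bound_lty (m : probability X R) (W : X -> R) (K e : R) : measurable_fun setT W ->
  (forall y, 1 + V y <= W y) -> 0 < K -> (\int[m]_y (tail W K y)%:E <= e%:E)%E ->
  (\int[m]_y (1 + V y)%:E < +oo)%E.
Proof.
move=> mW WV K0 te; have W0 y : 0 <= W y by apply: le_trans (WV y); rewrite addr_ge0.
have mtail : measurable_fun setT (fun y => (tail W K y)%:E).
  by apply/measurable_EFinP; exact: measurable_tail.
apply: (@le_lt_trans _ _ (\int[m]_y (K%:E + (tail W K y)%:E))%E).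
  apply: ge0_le_integral => //.
  - by move=> y _; rewrite lee_fin addr_ge0.
  - by apply/measurable_EFinP; exact: measurable_funD.
  - exact: emeasurable_funD.
  - by move=> y _; rewrite -EFinD lee_fin (le_trans (WV y))// le_tail// ltW.
rewrite ge0_integralD//.
- rewrite integral_cst_probability.
  by apply: le_lt_trans (leeD (lexx _) te) _; rewrite -EFinD ltry.
- by move=> y _; rewrite lee_fin ltW.
- by move=> y _; rewrite lee_fin tail_ge0.
Qed.

Lemma weight_average_lty T x : (\int[Q T x]_y (1 + V y)%:E < +oo)%E.
Proof.
have [W [mW WV ui]] := dominating_weight; have [K [K0 tQ _]] := ui x 1 ltr01.
exact: tail_bound_lty mW WV K0 (tQ T).
Qed.

Lemma weight_transition_lty t x : (\int[P t x]_y (1 + V y)%:E < +oo)%E.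
Proof.
have [W [mW WV ui]] := dominating_weight; have [K [K0 _ tP]] := ui x 1 ltr01.
exact: tail_bound_lty mW WV K0 (tP t).
Qed.

Lemma FF_integrable (m : {measure set X -> \bar R}) f :
  (\int[m]_y (1 + V y)%:E < +oo)%E -> FF_V V f -> m.-integrable setT (EFin \o f).
Proof.
move=> moo [mf fV]; apply: (@le_integrable _ _ _ m setT measurableT _ (fun y => (1 + V y)%:E)).
- exact/measurable_EFinP.
- by move=> y _ /=; rewrite lee_fin (le_trans (fV y))// ler_norm.
- apply: (ge0_integrable_lty measurableT) => //; first exact: measurable_funD.
  by move=> y _; rewrite addr_ge0.
Qed.

Let Pf_ge0 (s : R) x (h : X -> R) : 0 <= s -> measurable_fun setT h -> (forall y, 0 <= h y) ->
  (\int[P s x]_y (h y)%:E < +oo)%E ->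
  (Pf Px Phi s h x)%:E = (\int[P s x]_y (h y)%:E)%E.
Proof.
move=> s0 mh h0 hoo; rewrite /Pf.
have -> : (\int[Px x]_w (h (Phi s w))%:E = \int[P s x]_y (h y)%:E)%E.
  rewrite (P_spec s x).2; [|exact/measurable_EFinP|by move=> y; rewrite lee_fin].
  by rewrite (max_idPr s0).
by rewrite fineK// ge0_fin_numE// integral_ge0// => y _; rewrite lee_fin.
Qed.

(** The mixture formula is available for nonnegative functions, so [f] is written as the difference
    of [f + (1 + V)] and [1 + V]. Finiteness of every integral keeps [fine] from returning a default
    value. *)
Lemma Qf_expect (T : R) x f : 0 < T -> FF_V V f -> Qf Px Phi T f x = expect (Q T x) f.
Proof.
move=> T0 Ff; have [mf fV] := Ff.
have I0 : [set s : R | 0 <= s <= T] = `[0, T]%classic.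
  by apply/seteqP; split => s /=; rewrite in_itv.
pose h1 y := f y + (1 + V y); pose h2 y := 1 + V y.
have m2 : measurable_fun setT h2 by exact: measurable_funD.
have m1 : measurable_fun setT h1 by exact: measurable_funD.
have h10 y : 0 <= h1 y by rewrite /h1; have := fV y; rewrite ler_norml; lra.
have h20 y : 0 <= h2 y by rewrite addr_ge0.
have finh (m : {measure set X -> \bar R}) : (\int[m]_y (1 + V y)%:E < +oo)%E ->
    [/\ (\int[m]_y (h1 y)%:E < +oo)%E, (\int[m]_y (h2 y)%:E < +oo)%E,
        m.-integrable setT (EFin \o h1) & m.-integrable setT (EFin \o h2)].
  move=> moo; have i2 := FF_integrable moo FF_weight; have i0 := FF_integrable moo Ff.
  have i1 : m.-integrable setT (EFin \o h1) by exact: (integrableD measurableT i0 i2).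
  split => //.
  have := integrable_lty measurableT i1; exact.
pose phi (h : X -> R) (s : RR) : \bar R := (\int[P s x]_y (h y)%:E)%E.
have mphi (h : X -> R) : measurable_fun setT h -> (forall y, 0 <= h y) -> measurable_fun setT (phi h).
  by move=> mh h0; apply: measurable_int; [exact/measurable_EFinP|move=> y; rewrite lee_fin].
have key (h : X -> R) : measurable_fun setT h -> (forall y, 0 <= h y) ->
    (forall t, (\int[P t x]_y (h y)%:E < +oo)%E) -> (\int[Q T x]_y (h y)%:E < +oo)%E ->
    lebesgue_measure.-integrable `[0, T]%classic (fun s => (Pf Px Phi s h x)%:E) /\
    T^-1 * fine (\int[lebesgue_measure]_(s in `[0%R, T]) (Pf Px Phi s h x)%:E)%E =
    expect (Q T x) h.
  move=> mh h0 Poo Qoo.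
  have E (s : R) : s \in `[0, T]%classic -> (Pf Px Phi s h x)%:E = phi h s.
    by move=> /set_mem; rewrite /= in_itv/= => /andP[s0 _]; exact: Pf_ge0.
  have IE : (\int[lebesgue_measure]_(s in `[0%R, T]) (Pf Px Phi s h x)%:E =
      \int[lebesgue_measure]_(s in `[0%R, T]) phi h s)%E by exact: eq_integral.
  have phi0 s : (0 <= phi h s)%E by apply: integral_ge0 => y _; rewrite lee_fin.
  have QE : (\int[Q T x]_y (h y)%:E =
      T^-1%:E * \int[lebesgue_measure]_(s in `[0%R, T]) phi h s)%E.
    rewrite Q_spec; [|exact/measurable_EFinP|by move=> y; rewrite lee_fin].
    by rewrite (U_unif T0)//; exact: mphi.
  have I_fin : (\int[lebesgue_measure]_(s in `[0%R, T]) phi h s)%E \is a fin_num.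
    rewrite ge0_fin_numE ?integral_ge0//; rewrite QE in Qoo.
    rewrite ltey; apply/eqP => Ioo; move: Qoo; rewrite Ioo.
    by rewrite gt0_muley ?ltxx// lte_fin invr_gt0.
  split.
    apply/integrableP; split.
      apply: (eq_measurable_fun (phi h)); last exact: measurable_funS (mphi h mh h0).
      by move=> s sT; rewrite E.
    rewrite (eq_integral (phi h)) => [|s sT]; first by rewrite -ge0_fin_numE// integral_ge0.
    by rewrite E// gee0_abs.
  by rewrite IE /expect /Rintegral QE fineM.
have [Q1 Q2 iQ1 iQ2] := finh _ (weight_average_lty T x).
have [i1 e1] := key h1 m1 h10 (fun t => (let: And4 a _ _ _ := finh _ (weight_transition_lty t x) in a)) Q1.
have [i2 e2] := key h2 m2 h20 (fun t => (let: And4 _ a _ _ := finh _ (weight_transition_lty t x) in a)) Q2.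
have -> : expect (Q T x) f = expect (Q T x) h1 - expect (Q T x) h2.
  by rewrite -expectB//; congr expect; apply/funext => y; rewrite /h1 /h2 addrK.
rewrite -e1 -e2 -mulrBr /Qf I0; congr (_ * _).
rewrite -fineB; [|exact: (integrable_fin_num _ i1)|exact: (integrable_fin_num _ i2)].
rewrite -integralB_EFin//; congr fine; apply: eq_integral => s /set_mem.
rewrite /= in_itv/= => /andP[s0 _]; congr (_%:E).
have [P1 P2 iP1 iP2] := finh _ (weight_transition_lty s x).
have iPx (h : X -> R) : measurable_fun setT h -> (forall y, 0 <= h y) ->
    (\int[P s x]_y (h y)%:E < +oo)%E -> (Px x).-integrable setT (EFin \o (h \o Phi s)).
  move=> mh h0 hoo; apply: ge0_integrable_lty => //=.
    by apply: (measurableT_comp mh); case: markov => + _ _ _ _; exact.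
  move: hoo; rewrite (P_spec s x).2; [|exact/measurable_EFinP|by move=> y; rewrite lee_fin].
  by rewrite (max_idPr s0).
have := RintegralB measurableT (iPx h1 m1 h10 P1) (iPx h2 m2 h20 P2).
rewrite /Pf => <-; congr fine; apply: eq_integral => w _ /=.
by rewrite /h1 /h2 addrK.
Qed.

Lemma Qt_average (T : R) x A : 0 < T -> measurable A -> (Qt Px Phi T x A)%:E = Q T x A.
Proof.
move=> T0 mA; rewrite /Qt Qf_expect//; last exact/FF_unit/unit_fun_indic.
by rewrite expect_indic.
Qed.

(** The easy half of duality: under a coupling, [f p.1 - f p.2] vanishes on the diagonal and is at
    most the cost off it. *)
Let coupling_lower (m1 m2 : probability X R) (pi : probability (X * X)%type R) f :
  (forall A, measurable A -> pi (A `*` setT) = m1 A /\ pi (setT `*` A) = m2 A) ->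
  (\int[m1]_y (1 + V y)%:E < +oo)%E -> (\int[m2]_y (1 + V y)%:E < +oo)%E -> FF_V V f ->
  ((`|expect m1 f - expect m2 f|)%:E <=
   \int[pi]_(p in [set p : X * X | p.1 <> p.2]) (2 + V p.1 + V p.2)%:E)%E.
Proof.
move=> marg fin1 fin2 Ff; have [mf fV] := Ff.
have mD := measurable_offdiag rho_polish borel.
have mWE : measurable_fun setT (fun y => (1 + V y)%:E).
  by apply/measurable_EFinP; exact: measurable_funD.
have transfer (pr : X * X -> X) (m : probability X R) : measurable_fun setT pr ->
    (forall A, measurable A -> pi (pr @^-1` A) = m A) -> (\int[m]_y (1 + V y)%:E < +oo)%E ->
    pi.-integrable setT (EFin \o (f \o pr)) /\ expect m f = expect pi (f \o pr).
  move=> mpr mE moo.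
  have int_pi : pi.-integrable setT (EFin \o (f \o pr)).
    apply: (@le_integrable _ _ _ pi setT measurableT _ (fun p => (1 + V (pr p))%:E)).
    - by apply/measurable_EFinP; exact: (measurableT_comp mf mpr).
    - by move=> p _ /=; rewrite lee_fin (le_trans (fV _))// ler_norm.
    - apply: (ge0_integrable_lty measurableT).
      + by apply: measurable_funD => //; exact: (measurableT_comp mV mpr).
      + by move=> p _; rewrite addr_ge0.
      + apply: le_lt_trans moo; rewrite (@eq_measure_integral _ _ _ _ (pushforward pi pr) m)//.
          rewrite (@ge0_integral_pushforward _ _ _ _ _ pr mpr pi setT (fun y => (1 + V y)%:E))//.
          by move=> y _; rewrite lee_fin addr_ge0.
        by move=> A mA _; exact: esym (mE A mA).
  split => //; rewrite /expect /Rintegral; congr fine.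
  rewrite (@eq_measure_integral _ _ _ _ (pushforward pi pr) m)//.
    rewrite (@integral_pushforward _ _ _ _ _ pr mpr pi setT (fun y => (f y)%:E))//.
    exact/measurable_EFinP.
  by move=> A mA _; exact: esym (mE A mA).
have p1 A : measurable A -> pi (fst @^-1` A) = m1 A.
  by move=> mA; have [<- _] := marg A mA; congr (pi _); apply/seteqP; split => -[a b] //= [].
have p2 A : measurable A -> pi (snd @^-1` A) = m2 A.
  by move=> mA; have [_ <-] := marg A mA; congr (pi _); apply/seteqP; split => -[a b] //= [].
have [i1 ->] := transfer fst m1 measurable_fst p1 fin1.
have [i2 ->] := transfer snd m2 measurable_snd p2 fin2.
rewrite -expectB//; have i12 := integrableB measurableT i1 i2.
rewrite (EFin_normr_Rintegral measurableT i12).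
have m12 : measurable_fun setT (fun p : X * X => (f p.1 - f p.2)%:E).
  apply/measurable_EFinP; apply: measurable_funB.
    exact: (measurableT_comp mf measurable_fst).
  exact: (measurableT_comp mf measurable_snd).
apply: (le_trans (le_abse_integral _ measurableT m12)).
rewrite [leRHS]integral_mkcond; apply: ge0_le_integral => //.
- exact: measurableT_comp.
- apply/(measurable_restrictT _ mD).
  apply: measurable_funS (measurableT) _ _ => //; apply/measurable_EFinP.
  apply: measurable_funD; last exact: (measurableT_comp mV measurable_snd).
  by apply: measurable_funD => //; exact: (measurableT_comp mV measurable_fst).
- move=> [a b] _; rewrite patchE; case: ifPn => [_|].
    rewrite /= lee_fin; have := fV a; have := fV b; rewrite !ler_norml; lra.
  by rewrite notin_setE /= => /contrapT ->; rewrite subrr normr0.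
Qed.

Lemma dV_Q_lower (T : R) x (mu : probability X R) f : 0 < T ->
  (\int[mu]_y (1 + V y)%:E < +oo)%E -> FF_V V f ->
  ((`|Qf Px Phi T f x - expect mu f|)%:E <= dV_Q Px Phi V T x mu)%E.
Proof.
move=> T0 muoo Ff; rewrite Qf_expect//; apply: le_ereal_inf_tmp => _ [pi marg <-].
apply: coupling_lower => //; last exact: weight_average_lty.
by move=> A mA; have [-> ->] := marg A mA; rewrite Qt_average.
Qed.

Let near_dV x (mu : probability X R) (e : R) :
  (fun t => dV_Q Px Phi V t x mu) @ +oo%R --> 0%E -> 0 < e ->
  exists2 T0 : R, 0 < T0 & forall T, T0 <= T -> (dV_Q Px Phi V T x mu <= e%:E)%E.
Proof.
move=> lim e0; have ene : (0 < e%:E)%E by rewrite lte_fin.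
have [M [_ hM]] := lim _ (open_ereal_lt' ene).
exists (Num.max M 0 + 1); first by rewrite ltr_wpDl// le_max lexx orbT.
by move=> T MT; apply/ltW/hM; apply: lt_le_trans MT; rewrite ltr_pwDr// le_max lexx.
Qed.

(** All averages approach [mu] uniformly over the class, so the inner upper limit vanishes for every
    pair of points. For (C2), [z] is a point of the support of [mu]. *)
Lemma ucec_C2_of_limit (mu : probability X R) :
  (forall f, FF_V V f -> mu.-integrable setT (fun y => (f y)%:E)) ->
  (forall x, (fun t => dV_Q Px Phi V t x mu) @ +oo%R --> 0%E) ->
  (forall x, ucec_at Px Phi rho (FF_V V) x) /\ exists z, C2_at Px Phi rho z.
Proof.
move=> muFF lim.
have muoo : (\int[mu]_y (1 + V y)%:E < +oo)%E.
  exact: (integrable_lty measurableT (muFF _ FF_weight)).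
split.
  move=> x; have lims x' : limsup_infty (fun t =>
      ereal_sup [set (`|Qf Px Phi t f x' - Qf Px Phi t f x|)%:E | f in FF_V V]) = 0%E.
    apply: limsup_infty_eq0.
      (* An empty supremum would be -oo, so a member of the class is exhibited. *)
      move=> t; apply: le_ereal_sup_tmp; eexists; first by exists (fun y => 1 + V y).
      by rewrite lee_fin.
    move=> e e0; have e20 : 0 < e / 2 by rewrite divr_gt0.
    have [T1 T10 h1] := near_dV (lim x) e20; have [T2 T20 h2] := near_dV (lim x') e20.
    exists (Num.max T1 T2) => T; rewrite ge_max => /andP[T1T T2T].
    have T0 : 0 < T by exact: lt_le_trans T1T.
    apply: ge_ereal_sup => _ [f Ff <-]; rewrite lee_fin.
    have := le_trans (dV_Q_lower x T0 muoo Ff) (h1 T T1T).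
    have := le_trans (dV_Q_lower x' T0 muoo Ff) (h2 T T2T).
    by rewrite !lee_fin !ler_norml; lra.
  rewrite /ucec_at /rlimsup_at; apply/eqP; rewrite eq_le; apply/andP; split.
    apply: ge_ereal_inf; eexists; first by exists 1 => //=; exact: ltr01.
    by apply: ge_ereal_sup => _ [x' _ <-]; rewrite lims.
  apply: le_ereal_inf_tmp => _ [r /= r0 <-]; apply: le_ereal_sup_tmp.
  by exists 0%E => //; exists x; [exact: rball_center|exact: lims].
(* Otherwise [X] would be covered by countably many null balls with centres in a dense sequence. *)
have [z hz] : exists z, forall r : R, 0 < r -> 0 < expect mu \1_(rball rho z r).
  apply: contrapT => nz; have [_ _ [D denseD]] := rho_polish; have [rho0 rhoE rhoC rhoD] := rho_metric.
  have mball x (r : R) : measurable (rball rho x r).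
    by apply: (ropen_measurable borel); exact: ropen_rball.
  pose G n k := if pselect (expect mu \1_(rball rho (D n) k.+1%:R^-1) = 0)
    then rball rho (D n) k.+1%:R^-1 else set0.
  have mG n k : measurable (G n k).
    by rewrite /G; case: pselect => ?; [exact: mball|exact: measurable0].
  have cov : [set: X] = \bigcup_n \bigcup_k G n k.
    apply/seteqP; split => // y _.
    have [r [r0 nr]] : exists r : R, 0 < r /\ expect mu \1_(rball rho y r) <= 0.
      apply: contrapT => h; apply: nz; exists y => r r0; rewrite ltNge; apply/negP => le.
      by apply: h; exists r.
    have [k _ hk] := near_infty_natSinv_lt (PosNum (divr_gt0 r0 (ltr0n R 2))).
    have {}hk : k.+1%:R^-1 < r / 2 :> R by exact: (hk k (leqnn _)).
    have [|n hn] := denseD y (k.+1%:R^-1 : R); first by rewrite invr_gt0 ltr0n.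
    exists n => //; exists k => //; rewrite /G; case: pselect => [?|pos].
      by rewrite /rball/= rhoC.
    exfalso; apply: pos; apply/eqP; rewrite eq_le expect_ge0 ?andbT; last first.
      by move=> x; rewrite indicE ler0n.
    apply: le_trans nr; apply: le_expect_indic => // w; rewrite /rball/= => Dw.
    apply: le_lt_trans (rhoD y (D n) w) _; rewrite (splitr r).
    by apply: ltrD; apply: lt_trans hk.
  have : mu.-negligible [set: X].
    rewrite cov; apply: negligible_bigcup => n; apply: negligible_bigcup => k.
    apply/negligibleP => //; apply: etrans (esym (expect_indic _ (mG n k))) _.
    rewrite /G; case: pselect => [->//|?]; by rewrite expect_indic// measure0.
  move=> neg; have : mu setT = 0%E by apply/negligibleP.
  by rewrite probability_setT => /eqP; rewrite onee_eq0.
exists z => r r0; pose c := expect mu \1_(rball rho z r) / 2.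
have c0 : 0 < c by rewrite divr_gt0// hz.
apply: (@lt_le_trans _ _ c%:E); first by rewrite lte_fin.
apply: le_ereal_inf_tmp => _ [x _ <-]; apply: limsup_infty_ge => T0.
have [T1 T10 h1] := near_dV (lim x) c0.
exists (Num.max T0 T1); first by rewrite le_max lexx.
have T1m : T1 <= Num.max T0 T1 by rewrite le_max lexx orbT.
have mB : measurable (rball rho z r).
  by apply: (ropen_measurable borel); exact: ropen_rball.
have FB := FF_unit (unit_fun_indic (R := R) mB).
have := le_trans (dV_Q_lower x (lt_le_trans T10 T1m) muoo FB) (h1 _ T1m).
by rewrite /Qt !lee_fin ler_norml /c; lra.
Qed.

(** * Properties of the limit law *)

Section Limit.
Variable mu : probability X R.
Hypothesis mu_lim : forall x (e : R), 0 < e -> exists2 N : R, 0 < N & forall T f,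
  N <= T -> unit_fun f -> `|expect (Q T x) f - expect mu f| <= e.

(** Convergence is known for unit functions only: [h] is truncated at [n], scaled by 1/(n+1), and
    recovered by monotone convergence. *)
Lemma limit_integral_le x (h : X -> R) (c : R) : measurable_fun setT h ->
  (forall y, 0 <= h y) -> (forall T, (\int[Q T x]_y (h y)%:E <= c%:E)%E) ->
  (\int[mu]_y (h y)%:E <= c%:E)%E.
Proof.
move=> mh h0 hQ; pose g (n : nat) y := Num.min (h y) n%:R.
have mg n : measurable_fun setT (g n) by exact: measurable_minr.
have g0 n y : 0 <= g n y by rewrite le_min h0/=.
have gle n : (\int[mu]_y (g n y)%:E <= c%:E)%E.
  pose f y := n.+1%:R^-1 * g n y.
  have i0 : 0 <= n.+1%:R^-1 :> R by rewrite invr_ge0.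
  have uf : unit_fun f.
    split; first exact: measurable_funM.
    move=> y; rewrite mulr_ge0//= ler_pdivrMl ?ltr0n// mulr1 ge_min; apply/orP; right.
    by rewrite ler_nat.
  have fE (m : probability X R) : (expect m f)%:E = (n.+1%:R^-1%:E * \int[m]_y (g n y)%:E)%E.
    rewrite -expectE// -ge0_integralZl//.
    - exact/measurable_EFinP.
    - by move=> y _; rewrite lee_fin.
  suff : expect mu f <= n.+1%:R^-1 * c.
    by rewrite -lee_fin fE EFinM lee_pmul2l// lte_fin invr_gt0 ltr0n.
  apply/ler_addgt0Pr => e e0; have [N N0 hN] := mu_lim x e0.
  have : expect (Q N x) f <= n.+1%:R^-1 * c.
    rewrite -lee_fin fE EFinM; apply: lee_wpmul2l => //.
    apply: le_trans (hQ N); apply: ge0_le_integral => //.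
    - by move=> y _; rewrite lee_fin.
    - exact/measurable_EFinP.
    - exact/measurable_EFinP.
    - by move=> y _; rewrite lee_fin ge_min lexx.
  by have := hN N f (lexx _) uf; move: (_ * c) => b; rewrite ler_norml; lra.
have lim : (\int[mu]_y (g n y)%:E)%E @[n --> \oo] --> (\int[mu]_y (h y)%:E)%E.
  have -> : (\int[mu]_y (h y)%:E = \int[mu]_y limn (fun n => (g n y)%:E))%E.
    apply: eq_integral => y _; apply/esym/cvg_lim => //; apply: cvg_near_cst.
    exists (Num.bound (h y)) => // n /= hn; congr (_%:E); apply/min_idPl.
    by apply/ltW/(lt_le_trans (archi_boundP (h0 y))); rewrite ler_nat.
  apply: cvg_monotone_convergence => //.
  - by move=> n; exact/measurable_EFinP.
  - by move=> n y _; rewrite lee_fin.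
  - move=> y _ m n mn; rewrite lee_fin le_min !ge_min lexx /=.
    by rewrite ler_nat mn orbT.
rewrite -(cvg_lim _ lim)//; apply: lime_le; first by apply/cvg_ex; eexists; exact: lim.
exact: nearW.
Qed.

(** Convergence holds on all unit functions, so the merely measurable $P_t 1_A$ is an admissible
    test function; a further run of length [t] moves the averages by at most t/T. *)
Lemma limit_invariant (z : X) : is_invariant Px Phi mu.
Proof.
move=> t A t0 mA; have uA := unit_fun_indic (R := R) mA.
have uP := unit_transition_space markov P_spec t uA.
rewrite (eq_integral (fun y => (expect (P t y) \1_A)%:E)); last first.
  by move=> y _; rewrite expect_indic// (P_spec t y).1// (max_idPr t0).
rewrite expectE// -expect_indic//; congr (_%:E).
apply/eqP; rewrite -subr_eq0 -normr_le0; apply/ler_addgt0Pr => e e0; rewrite add0r.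
have e30 : 0 < e / 3 by rewrite divr_gt0.
have [N N0 hN] := mu_lim z e30; pose T := Num.max N (t / (e / 3)).
have NT : N <= T by rewrite le_max lexx.
have T0 : 0 < T by exact: lt_le_trans NT.
have tT : t / T <= e / 3.
  by rewrite ler_pdivrMr// mulrC -ler_pdivrMr// le_max lexx orbT.
have := le_trans (average_transition_shift rho_polish borel markov P_spec U_unif Q_spec z T0 t0 uA) tT.
by have := hN T _ NT uP; have := hN T _ NT uA; rewrite !ler_norml; lra.
Qed.

(** An invariant [nu] is unchanged by averaging, by Fubini; dominated convergence sends the averaged
    indicator to the constant [mu A]. *)
Lemma limit_unique (nu : probability X R) : is_invariant Px Phi nu ->
  forall A, measurable A -> nu A = mu A.
Proof.
move=> inv A mA; have uA := unit_fun_indic (R := R) mA.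
have invP (s : R) : expect nu (fun y => expect (P s y) \1_A) = expect nu \1_A.
  have uP := unit_transition_space markov P_spec s uA.
  apply: EFin_inj; rewrite -expectE// expect_indic// -(inv _ A (max0_ge0 s) mA).
  by apply: eq_integral => y _; rewrite expect_indic// (P_spec s y).1.
have invQ (T : R) : expect nu (fun y => expect (Q T y) \1_A) = expect nu \1_A.
  rewrite (_ : (fun y => _) = (fun y => expect (U T) (fun s => expect (P s y) \1_A))); last first.
    by apply/funext => y; rewrite (expect_average rho_polish borel markov P_spec Q_spec).
  rewrite -(expect_fubini (U T) nu (unit_transition rho_polish borel markov P_spec uA)) /=.
  rewrite (_ : (fun s => _) = (fun=> expect nu \1_A)) ?expect_cst//.
  by apply/funext => s; exact: invP.
have lim : (fun n => expect nu (fun y => expect (Q n.+1%:R y) \1_A)) @ \oo -->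
    expect nu (fun=> expect mu \1_A).
  apply: expect_cvg.
  - by move=> n; exact: (unit_average rho_polish borel markov P_spec Q_spec).
  - by apply: unit_fun_cst; rewrite expect_le1// expect_ge0// => x; rewrite indicE ler0n.
  - move=> y; apply/cvgn_dist => e e0; have [N N0 hN] := mu_lim y e0.
    exists (Num.bound N) => n Nn; apply: hN => //.
    by apply/ltW/(lt_le_trans (archi_boundP (ltW N0))); rewrite ler_nat leqW.
rewrite -!expect_indic//; congr (_%:E); rewrite -[RHS](expect_cst nu).
rewrite -(cvg_lim _ lim)//; under eq_fun do rewrite invQ.
by rewrite lim_cst.
Qed.

Lemma limit_dV x : (fun t => dV_Q Px Phi V t x mu) @ +oo%R --> 0%E.
Proof.
have [W [mW WV ui]] := dominating_weight.
have W0 y : 0 <= W y by apply: le_trans (WV y); rewrite addr_ge0.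
have dV0 t : (0 <= dV_Q Px Phi V t x mu)%E.
  apply: le_ereal_inf_tmp => _ [pi _ <-]; apply: integral_ge0 => p _.
  by rewrite lee_fin !addr_ge0.
have small (e : R) : 0 < e -> exists N : R, forall T, N < T -> (dV_Q Px Phi V T x mu <= e%:E)%E.
  move=> e0; have e40 : 0 < e / 4 by rewrite divr_gt0.
  have [K [K0 tQ _]] := ui x _ e40.
  have tmu : (\int[mu]_y (tail W K y)%:E <= (e / 4)%:E)%E.
    by apply: (limit_integral_le (x := x)) => //; [exact: measurable_tail|move=> y; exact: tail_ge0].
  (* Total variation enters the coupling bound with factor 2K and so costs e/2; the two tails cost
     e/4 each. *)
  have d0 : 0 < e / (4 * K) by rewrite divr_gt0// mulr_gt0.
  have [N N0 hN] := mu_lim x d0; exists N => T NT; have T0 := lt_trans N0 NT.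
  have mw : measurable_fun setT (fun y => 1 + V y) by exact: measurable_funD.
  have w0 y : 0 <= 1 + V y by rewrite addr_ge0.
  have [S [pi [mS marg bound]]] := maximal_coupling rho_polish borel (Q T x) mu mw w0.
  apply: ge_ereal_inf; eexists.
    by exists pi => //= A mA; have [-> ->] := marg A mA; rewrite Qt_average.
  rewrite (eq_integral (fun p : X * X => ((1 + V p.1) + (1 + V p.2))%:E)); last first.
    by move=> p _; congr (_%:E); lra.
  have := bound K (tail W K) (ltW K0) (measurable_tail K mW) (fun y => tail_ge0 K (W0 y)).
  move=> /(_ _)/le_trans; apply.
    by move=> y; apply: le_trans (WV y) _; apply: le_tail; exact: ltW.
  apply: (@le_trans _ _ ((e / 2)%:E + (e / 4)%:E + (e / 4)%:E)%E); last first.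
    by rewrite -!EFinD lee_fin; lra.
  apply: leeD => //; apply: leeD => //.
  rewrite -!expect_indic// -EFinB -EFinM lee_fin.
  have := hN T _ (ltW NT) (unit_fun_indic (R := R) mS); rewrite ler_norml => /andP[_ h].
  apply: (@le_trans _ _ (2 * K * (e / (4 * K)))).
    by rewrite ler_pM2l// mulr_gt0.
  rewrite le_eqVlt; apply/orP; left; apply/eqP; field; exact: lt0r_neq0.
have fin (T c : R) : (dV_Q Px Phi V T x mu <= c%:E)%E -> dV_Q Px Phi V T x mu \is a fin_num.
  by move=> le; rewrite ge0_fin_numE// (le_lt_trans le)// ltry.
apply/fine_cvgP; split.
  have [N hN] := small 1 ltr01; exists N; split; first exact: num_real.
  by move=> T /hN; exact: fin.
apply/cvgrPdist_le => e e0; have [N hN] := small e e0.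
exists N; split; first exact: num_real.
move=> T /hN le /=; rewrite sub0r normrN ger0_norm ?fine_ge0//.
by rewrite -lee_fin fineK//; exact: fin le.
Qed.
End Limit.

Lemma limit_of_ucec_C2 z : ucec_at Px Phi rho (FF_V V) z -> C2_at Px Phi rho z ->
  exists mu : probability X R,
    [/\ is_invariant Px Phi mu,
        (forall nu : probability X R, is_invariant Px Phi nu ->
           forall A, measurable A -> nu A = mu A),
        (forall f, FF_V V f -> mu.-integrable setT (fun y => (f y)%:E)) &
        (forall x, (fun t => dV_Q Px Phi V t x mu) @ +oo%R --> 0%E)].
Proof.
move=> ucec c2.
have [mu mu_lim] : exists mu : probability X R, forall x (e : R), 0 < e ->
    exists2 N : R, 0 < N & forall T f, N <= T -> unit_fun f ->
    `|expect (Q T x) f - expect mu f| <= e.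
  apply: (@averages_converge R d X rho rho_polish borel Q _ _ _ _ z).
  - by move=> T A _ mA; exact: (measurable_average rho_polish borel markov P_spec Q_spec).
  - exact: (average_shift1 rho_polish borel markov P_spec U_unif Q_spec).
  - exact: (average_shift2 rho_polish borel markov P_spec U_unif Q_spec).
  - exact: (feller_average rho_polish borel markov P_spec Q_spec).
  - move=> e e0; have : (rlimsup_at rho z (fun x' => limsup_infty (fun t =>
        ereal_sup [set (`|Qf Px Phi t f x' - Qf Px Phi t f z|)%:E | f in FF_V V])) < e%:E)%E.
      by rewrite ucec lte_fin.
    move=> /ereal_inf_lt[_ [r r0 <-] lt]; exists r => // y zy.
    have /limsup_infty_lt[T0 hT0] : (limsup_infty (fun t => ereal_sup
        [set (`|Qf Px Phi t f y - Qf Px Phi t f z|)%:E | f in FF_V V]) < e%:E)%E.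
      by apply: le_lt_trans lt; apply: ereal_sup_ubound; exists y.
    (* The 1 ensures positive times, which [Qf_expect] requires. *)
    exists (Num.max T0 1); first by rewrite lt_max ltr01 orbT.
    move=> T; rewrite ge_max => /andP[T0T T1] f uf; have Tp := lt_le_trans ltr01 T1.
    rewrite -!Qf_expect//; [|exact: FF_unit..].
    rewrite -lee_fin; apply/ltW; apply: le_lt_trans (hT0 T T0T).
    by apply: ereal_sup_ubound; exists f => //; exact: FF_unit.
  - move=> r r0; have mB : measurable (rball rho z r).
      by apply: (ropen_measurable borel); exact: ropen_rball.
    have := c2 r r0; set a := ereal_inf _ => a0.
    have [c c0 ca] : exists2 c : R, 0 < c & (c%:E < a)%E.
      move: a0; case: a => [b| |//]; last by exists 1 => //; exact: ltry.
      by rewrite lte_fin => b0; exists (b / 2); rewrite ?divr_gt0// lte_fin; lra.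
    exists c => // x T0.
    have /(@limsup_infty_gt _ _ _ (Num.max T0 1))[T] :
        (c%:E < limsup_infty (fun t => (Qt Px Phi t x (rball rho z r))%:E))%E.
      by apply: lt_le_trans ca _; apply: ereal_inf_lbound; exists x.
    rewrite ge_max => /andP[T0T T1]; have Tp := lt_le_trans ltr01 T1.
    rewrite Qt_average// -expect_indic// lte_fin => cT.
    by exists T; split => //; exact: ltW.
have [W [mW WV ui]] := dominating_weight.
have [K [K0 tQ _]] := ui z 1 ltr01.
exists mu; split.
- exact: limit_invariant mu_lim z.
- exact: limit_unique mu_lim.
- move=> f Ff; apply: FF_integrable => //; apply: (tail_bound_lty mW WV K0 (e := 1)).
  apply: (limit_integral_le mu_lim (x := z)) => //; first exact: measurable_tail.
  by move=> y; apply: tail_ge0; apply: le_trans (WV y); rewrite addr_ge0.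
- exact: limit_dV mu_lim.
Qed.
End WeightedAverages.

Unset Implicit Arguments.

Theorem mainTheorem8 (R : realType) (d : measure_display) (X : measurableType d)
  (rho : X -> X -> R) (dO : measure_display) (Omega : measurableType dO)
  (Px : X -> probability Omega R) (Phi : R -> Omega -> X) (V : X -> R) :
  polish rho ->
  @measurable d X = <<s ropen rho >> ->
  cadlag_feller_markov Px Phi rho ->
  (forall x, 0 <= V x) -> rcontinuous rho V ->
  H2 Px Phi (FF_V V) ->
  let i := exists mu : probability X R,
      [/\ is_invariant Px Phi mu,
          (forall nu : probability X R, is_invariant Px Phi nu ->
             forall A, measurable A -> nu A = mu A),
          (forall f, FF_V V f -> mu.-integrable setT (fun y => (f y)%:E)) &
          (forall x, (fun t => dV_Q Px Phi V t x mu) @ +oo%R --> 0%E)] in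
  let ii := (forall x, ucec_at Px Phi rho (FF_V V) x) /\
            exists z, C2_at Px Phi rho z in
  let iii := exists z, ucec_at Px Phi rho (FF_V V) z /\ C2_at Px Phi rho z in
  (i <-> ii) /\ (ii <-> iii).
Proof.
move=> polish_rho borel markov V_ge0 V_cont V_H2 i ii iii.
have [P P_spec] := transition_exists markov.
have [U U_unif] := @uniform_exists R.
have [Q Q_spec] := average_exists polish_rho borel markov P_spec U.
have i_ii : i -> ii.
  move=> [mu [_ _ muFF lim]].
  exact: (ucec_C2_of_limit polish_rho borel markov V_ge0 V_cont V_H2 P_spec U_unif Q_spec muFF lim).
have ii_iii : ii -> iii by move=> [ucec [z c2]]; exists z; split.
have iii_i : iii -> i.
  move=> [z [ucec c2]].
  exact: (limit_of_ucec_C2 polish_rho borel markov V_ge0 V_cont V_H2 P_spec U_unif Q_spec ucec c2).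
split; split => //; first by move=> /ii_iii/iii_i.
by move=> /iii_i/i_ii.
Qed.
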